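(* Let $f_i(x)=\frac12x^TQ_ix-p_i^Tx+r_i$ for $i=1,\dots,N$, and consider the D-SG (distributed stochastic gradient) iterates $x^{(k+1)}=\mathcal{W}x^{(k)}-\alpha\left[\nabla F(x^{(k)})+w^{(k+1)}\right]$ with stepsize $\alpha>0$ and additive i.i.d. noise. Let $\mu_1,\dots,\mu_{Nd}$ be the eigenvalues of $A_Q=\mathcal W-\alpha Q$, let $\rho_{\mathrm{dsg}}:=\max_{1\le i\le Nd}|\mu_i|$, and let $\xi_0=x^{(0)}-x^\infty$. For every $k\in\mathbb{N}$, $$\mathbb{E}\left[\|x^{(k)}-x^\infty\|^2\right]\le\rho_{\mathrm{dsg}}^{2k}\left(\|\xi_0\xi_0^T\|+\frac{\alpha^2\sigma^2N}{1-\rho_{\mathrm{dsg}}^2}\right)+\alpha^2\frac{\sigma^2}{d}\sum_{i=1}^{Nd}\frac{1}{1-\mu_i^2}.$$ In particular, if $\alpha\in\left(0,\frac{1+\lambda_N^W}{L+\mu}\right]$, then $$\mathbb{E}\left[\|x^{(k)}-x^\infty\|^2\right]\le(1-\alpha\mu)^{2k}\left(\|\xi_0\xi_0^T\|+\frac{\alpha^2\sigma^2N}{1-(1-\alpha\mu)^2}\right)+\alpha^2\frac{\sigma^2}{d}\sum_{i=1}^{Nd}\frac{1}{1-\mu_i^2}.$$ In addition, if we have $\alpha\in\left(0,\frac{1}{L+\mu}\right]$, then $$\mathbb{E}\left[\|x^{(k)}-x^*\|^2\right]\le(1-\alpha\mu)^{2k}\left(2\|\xi_0\xi_0^T\|+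\frac{2\alpha^2\sigma^2N}{1-(1-\alpha\mu)^2}\right)+\frac{2\alpha^2\sigma^2}{d}\sum_{i=1}^{Nd}\frac{1}{1-\mu_i^2}+\frac{2\alpha^2C_1^2N}{(1-\gamma)^2}.$$
   Context: Each $Q_i$ is a symmetric positive definite $d\times d$ matrix with $\mu I_d\preceq Q_i\preceq LI_d$ ($0<\mu\le L$; i.e. each $f_i$ is $\mu$-strongly convex with $L$-Lipschitz gradient), $p_i\in\mathbb{R}^d$, $r_i\in\mathbb{R}$. $F(x_1,\dots,x_N)=\sum_{i=1}^Nf_i(x_i)=\frac12x^TQx-p^Tx+r$ on $\mathbb{R}^{Nd}$, with $Q=\mathrm{diag}(Q_1,\dots,Q_N)$ (block diagonal), $p=[p_1^T,\dots,p_N^T]^T$, $r=\sum_ir_i$. $x_*$ is the minimizer of $\frac1N\sum_if_i$ over $\mathbb{R}^d$ and $x^*=[x_*^T,\dots,x_*^T]^T\in\mathbb{R}^{Nd}$. Network: $W$ is a symmetric doubly stochastic $N\times N$ matrix associated with a connected undirected graph on $\{1,\dots,N\}$ (for $i\neq j$, $W_{ij}>0$ if $(i,j)$ is an edge and $W_{ij}=0$ otherwise; $W_{ii}>0$), with eigenvalues $1=\lambda_1^W>\lambda_2^W\ge\cdots\ge\lambda_N^W>-1$; $\gamma:=\max\{|\lambda_2^W|,|\lambda_N^W|\}$; $\mathcal W:=W\otimes I_d$. Noise: the gradient estimate at node $i$ is $\nabla f_i$ plus additive noise; $w^{(k)}=[(w_1^{(k)})^T,\dots,(w_N^{(k)})^T]^T\in\mathbb{R}^{Nd}$,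 where the $w_i^{(k)}$ are i.i.d. over all $i$ and $k$ with zero mean and covariance $\frac{\sigma^2}{d}I_d$, the noise used at each iteration being independent of the past. $x^{(k)}\in\mathbb{R}^{Nd}$ stacks the node variables $x_i^{(k)}\in\mathbb{R}^d$; $x^{(0)}$ is a given (non-random) initial point. $x^\infty\in\mathbb{R}^{Nd}$ is the unique solution of $(I_{Nd}-\mathcal W)x^\infty+\alpha\nabla F(x^\infty)=0$. $\|\cdot\|$ is the Euclidean norm for vectors and the spectral norm for matrices. Constant: $C_1:=\sqrt{2L\sum_{i=1}^N(f_i(0)-f_i^* )}\cdot\left(1+\frac{2(L+\mu)}{\mu}\right)$ with $f_i^*:=\min_{x\in\mathbb{R}^d}f_i(x)$.
   Formalization: The first bound is stated under the added assumption ρ_dsg < 1 (it fails for αμ > 2, k = 0, x^(0) = x^∞, σ > 0); the last bound assumes both α ≤ (1+λ_N^W)/(L+μ) and α ≤ 1/(L+μ), since the latter alone allows divergence. *)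

(* Defs.v *)
From mathcomp Require Export all_boot all_order all_algebra.
(* mxtens (real_closed) provides the Kronecker product `*t`. *)
From mathcomp Require Export mxtens.
From mathcomp Require Export all_classical all_reals all_analysis.
Export Order.TTheory GRing.Theory Num.Theory.
Export numFieldNormedType.Exports.

Set Implicit Arguments.
Unset Strict Implicit.
Unset Printing Implicit Defensive.

Local Open Scope classical_set_scope.
Local Open Scope ring_scope.

Section LinearAlgebra.
Context {R : realType}.

(* The library's norm `|v| on matrices is the max norm, hence this definition. *)
Definition l2norm (n : nat) (v : 'cV[R]_n) : R :=
  Num.sqrt (\sum_i v i 0 ^+ 2).

Definition spectral_norm (m n : nat) (A : 'M[R]_(m, n)) : R :=
  sup [set l2norm (A *m v) | v in [set v : 'cV[R]_n | l2norm v <= 1]].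

Definition psd (n : nat) (A : 'M[R]_n) : Prop :=
  A^T = A /\ forall v : 'cV[R]_n, 0 <= (v^T *m A *m v) 0 0.

Definition loewner_le (n : nat) (A B : 'M[R]_n) : Prop := psd (B - A).

(* Real eigenvalues, repeated according to algebraic multiplicity. *)
Definition is_spectrum (n : nat) (A : 'M[R]_n) (s : seq R) : Prop :=
  char_poly A = \prod_(l <- s) ('X - l%:P).

(* R^(Nd) is 'cV[R]_(N * d); entry s of block i sits at mxtens_index (i, s),
   which is the convention of the Kronecker product `*t`. *)
Definition stack (N d : nat) (v : 'I_N -> 'cV[R]_d) : 'cV[R]_(N * d) :=
  \col_a v (mxtens_unindex a).1 (mxtens_unindex a).2 0.

Definition block (N d : nat) (x : 'cV[R]_(N * d)) (i : 'I_N) : 'cV[R]_d :=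
  \col_s x (mxtens_index (i, s)) 0.

Definition block_diag (N d : nat) (Q : 'I_N -> 'M[R]_d) : 'M[R]_(N * d) :=
  \sum_i (delta_mx i i *t Q i).

End LinearAlgebra.

Section Objective.
Context {R : realType}.

Definition quad (d : nat) (Q : 'M[R]_d) (p : 'cV[R]_d) (r : R)
    (x : 'cV[R]_d) : R :=
  2^-1 * (x^T *m Q *m x) 0 0 - (p^T *m x) 0 0 + r.

Definition grad (n : nat) (f : 'cV[R]_n -> R) (x : 'cV[R]_n) : 'cV[R]_n :=
  \col_j 'D_(delta_mx j 0) f x.

Definition separable_sum (N d : nat) (f : 'I_N -> 'cV[R]_d -> R)
    (x : 'cV[R]_(N * d)) : R :=
  \sum_i f i (block x i).

Definition average (N d : nat) (f : 'I_N -> 'cV[R]_d -> R)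
    (x : 'cV[R]_d) : R :=
  N%:R^-1 * \sum_i f i x.

Definition is_minimizer (n : nat) (f : 'cV[R]_n -> R) (x : 'cV[R]_n) : Prop :=
  forall y, f x <= f y.

Definition is_minimum (n : nat) (f : 'cV[R]_n -> R) (m : R) : Prop :=
  exists2 x, is_minimizer f x & f x = m.

End Objective.

Section Network.
Context {R : realType}.

Definition connected_graph (N : nat) (e : rel 'I_N) : Prop :=
  [/\ symmetric e, irreflexive e & forall i j, connect e i j].

Definition doubly_stochastic (N : nat) (W : 'M[R]_N) : Prop :=
  [/\ forall i j, 0 <= W i j,
      forall i, \sum_j W i j = 1 & forall j, \sum_i W i j = 1].

Definition compatible_with_graph (N : nat) (e : rel 'I_N) (W : 'M[R]_N) : Prop :=
  (forall i, 0 < W i i) /\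
  forall i j, i != j -> (e i j -> 0 < W i j) /\ (~~ e i j -> W i j = 0).

End Network.

Section Noise.
Context {R : realType}.

Definition borel_cV (d : nat) := g_sigma_algebraType (@open 'cV[R]_d).

Context (disp : measure_display) (T : measurableType disp)
        (P : probability T R).

Definition mutually_independent (I : choiceType) (d : nat)
    (X : I -> {RV P >-> borel_cV d}) : Prop :=
  forall (s : seq I) (B : I -> set (borel_cV d)),
    uniq s -> (forall i, measurable (B i)) ->
    P (\bigcap_(i in [set` s]) (X i @^-1` B i)) =
    (\prod_(i <- s) P (X i @^-1` B i))%E.

Definition identically_distributed (I : choiceType) (d : nat)
    (X : I -> {RV P >-> borel_cV d}) : Prop :=
  forall i j B, measurable B -> distribution P (X i) B = distribution P (X j) B.

Definition coord (d : nat) (X : T -> borel_cV d) (s : 'I_d) : T -> R :=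
  fun t => (X t : 'cV[R]_d) s 0.

Definition zero_mean (d : nat) (X : T -> borel_cV d) : Prop :=
  forall s, ('E_P[coord X s] = 0)%E.

Definition has_covariance (d : nat) (X : T -> borel_cV d) (S : 'M[R]_d) : Prop :=
  (forall s, coord X s \in Lfun P 2%:E) /\
  forall s s', covariance P (coord X s) (coord X s') = (S s s')%:E.

End Noise.

Section Iterates.
Context {R : realType} (N d : nat).

(* `noise k` is the noise entering the step from iterate k to iterate k + 1. *)
Fixpoint dsg (W : 'M[R]_N) (alpha : R) (gradF : 'cV[R]_(N * d) -> 'cV[R]_(N * d))
    (x0 : 'cV[R]_(N * d)) (noise : nat -> 'cV[R]_(N * d)) (k : nat)
    : 'cV[R]_(N * d) :=
  if k is k'.+1 then
    let x := dsg W alpha gradF x0 noise k' in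
    (W *t (1%:M : 'M[R]_d)) *m x - alpha *: (gradF x + noise k')
  else x0.

End Iterates.

(* Main.v *)
(* The error [x^(k) - xinf] satisfies a linear recursion driven by the symmetric
   matrix [A = W (x) I - alpha Q], so it equals [A^k xi0] minus
   [alpha] times the sum of the [A^(k-1-j) w^(j)].  Since the noise coordinates
   are centred and uncorrelated, the second moment is exactly
   [|A^k xi0|^2 + alpha^2 (sigma^2/d) sum_(j < k) tr A^(2j)].  Diagonalizing [A]
   bounds the first term by [rho^(2k) |xi0|^2] and the traces by geometric series
   in the eigenvalues.
   For the distance to the optimum, split [xinf - x^*] into the deviation [y] of
   [xinf] from its mean and the deviation [z] of the mean from the optimum.  The
   spectral gap of [W] on the orthogonal complement of the constants gives
   [(1 - lam2) |y| <= alpha |grad F (xinf)|], the gradient is bounded by the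
   initial suboptimality because [xinf] minimizes a penalized objective, and the
   vanishing of the sums of gradients at [xinf] and at the optimum gives
   [mu N |z|^2 <= L |y|^2]. *)

Require Import Defs.
From mathcomp Require Import all_boot all_order all_algebra.
From mathcomp Require Import mxtens ring lra.
From mathcomp Require Import all_classical all_reals all_analysis.
From mathcomp Require Import measurable_realfun.
Import Order.TTheory GRing.Theory Num.Theory.
Import numFieldNormedType.Exports.
Set Implicit Arguments.
Unset Strict Implicit.
Unset Printing Implicit Defensive.
Local Open Scope classical_set_scope.
Local Open Scope ring_scope.

(** * Euclidean geometry of column vectors *)

Section Dot.
Context {R : realType}.

Definition dot n (u v : 'cV[R]_n) : R := (u^T *m v) 0 0.

Lemma dotE n (u v : 'cV[R]_n) : dot u v = \sum_i u i 0 * v i 0.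
Proof. by rewrite /dot mxE; apply: eq_bigr => i _; rewrite mxE. Qed.

Lemma dotC n (u v : 'cV[R]_n) : dot u v = dot v u.
Proof. by rewrite !dotE; apply: eq_bigr => i _; rewrite mulrC. Qed.

Lemma dotDr n (u v w : 'cV[R]_n) : dot u (v + w) = dot u v + dot u w.
Proof. by rewrite /dot mulmxDr mxE. Qed.

Lemma dotDl n (u v w : 'cV[R]_n) : dot (u + v) w = dot u w + dot v w.
Proof. by rewrite dotC dotDr !(dotC w). Qed.

Lemma dotZr n (u v : 'cV[R]_n) (a : R) : dot u (a *: v) = a * dot u v.
Proof. by rewrite /dot -scalemxAr mxE. Qed.

Lemma dotZl n (u v : 'cV[R]_n) (a : R) : dot (a *: u) v = a * dot u v.
Proof. by rewrite dotC dotZr dotC. Qed.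

Lemma dotNr n (u v : 'cV[R]_n) : dot u (- v) = - dot u v.
Proof. by rewrite -scaleN1r dotZr mulN1r. Qed.

Lemma dotNl n (u v : 'cV[R]_n) : dot (- u) v = - dot u v.
Proof. by rewrite dotC dotNr dotC. Qed.

Lemma dot0r n (u : 'cV[R]_n) : dot u 0 = 0.
Proof. by rewrite /dot mulmx0 mxE. Qed.

Lemma dot0l n (u : 'cV[R]_n) : dot 0 u = 0.
Proof. by rewrite dotC dot0r. Qed.

Lemma dot_sumr n (I : finType) (u : 'cV[R]_n) (v : I -> 'cV[R]_n) :
  dot u (\sum_i v i) = \sum_i dot u (v i).
Proof.
by apply: (big_morph (dot u)) => [x y|]; [exact: dotDr | exact: dot0r].
Qed.

Lemma dot_mulmx m n (A : 'M[R]_(m, n)) (u : 'cV[R]_m) (v : 'cV[R]_n) :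
  dot u (A *m v) = dot (A^T *m u) v.
Proof. by rewrite /dot trmx_mul trmxK mulmxA. Qed.

Lemma dot_delta n (i : 'I_n) (u : 'cV[R]_n) : dot (delta_mx i 0) u = u i 0.
Proof. by rewrite /dot trmx_delta -rowE mxE. Qed.

Lemma dot_ge0 n (u : 'cV[R]_n) : 0 <= dot u u.
Proof. by rewrite dotE sumr_ge0// => i _; rewrite -expr2 sqr_ge0. Qed.

Lemma dot_eq0 n (u : 'cV[R]_n) : (dot u u == 0) = (u == 0).
Proof.
apply/idP/eqP => [|->]; last by rewrite dot0r.
rewrite dotE psumr_eq0 => [/allP u0|i _]; last by rewrite -expr2 sqr_ge0.
apply/colP => i; rewrite mxE; apply/eqP.
by have /implyP/(_ isT) := u0 i (mem_index_enum i); rewrite mulf_eq0 orbb.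
Qed.

Lemma dot_gt0 n (u : 'cV[R]_n) : (0 < dot u u) = (u != 0).
Proof. by rewrite lt_neqAle dot_ge0 andbT eq_sym dot_eq0. Qed.

Lemma l2norm_sqr n (u : 'cV[R]_n) : l2norm u ^+ 2 = dot u u.
Proof.
rewrite /l2norm sqr_sqrtr; last by rewrite sumr_ge0// => i _; rewrite sqr_ge0.
by rewrite dotE; apply: eq_bigr => i _; rewrite expr2.
Qed.

(** The division-free residual [dot u u *: v - dot u v *: u] has squared length [dot u u] times the
    difference of the two sides. *)
Lemma cauchy_schwarz n (u v : 'cV[R]_n) : dot u v ^+ 2 <= dot u u * dot v v.
Proof.
have [->|u0] := eqVneq u 0; first by rewrite !dot0l expr0n mul0r.
have := dot_ge0 (dot u u *: v - dot u v *: u).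
rewrite dotDl !dotDr !dotNl !dotNr !dotZl !dotZr (dotC v u).
rewrite (_ : _ + _ = dot u u * (dot u u * dot v v - dot u v ^+ 2)); last by ring.
by rewrite pmulr_rge0 ?dot_gt0// subr_ge0.
Qed.

Lemma trmx_expr_sym n (A : 'M[R]_n) k : A^T = A -> (A ^+ k)^T = A ^+ k.
Proof.
move=> Asym; elim: k => [|k IH]; first by rewrite expr0 trmx1.
by rewrite exprS trmx_mul IH Asym -[LHS]/(A ^+ k * A) -exprSr exprS.
Qed.

Lemma dot_expr n (A : 'M[R]_n) (v : 'cV[R]_n) k : A^T = A ->
  dot (A ^+ k *m v) (A ^+ k *m v) = dot v (A ^+ (2 * k) *m v).
Proof.
move=> Asym; rewrite dot_mulmx dotC trmx_expr_sym//; congr dot.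
by rewrite mulmxA mulmxE -exprD addnn mul2n.
Qed.

(** The supremum is tested at the unit vector along [u], whose image has length [dot u u];
    Cauchy-Schwarz bounds the set, so that [sup] dominates its elements. *)
Lemma spectral_norm_outer n (u : 'cV[R]_n) :
  dot u u <= spectral_norm (u *m u^T).
Proof.
have outer v : l2norm (u *m u^T *m v) ^+ 2 = dot u u * dot u v ^+ 2.
  rewrite l2norm_sqr -mulmxA (mx11_scalar (u^T *m v)) -/(dot u v).
  by rewrite mul_mx_scalar dotZl dotZr expr2; ring.
have n0 v : 0 <= l2norm v :> R by apply: sqrtr_ge0.
(* A zero [u] cannot be normalized; the set is then tested at the zero vector. *)
have [u0|u0] := eqVneq u 0.
  rewrite {1}u0 dot0l /spectral_norm.
  apply: le_trans (_ : 0 <= l2norm (u *m u^T *m 0)) _ => //.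
  apply: ub_le_sup; last first.
    exists 0 => //=.
    by rewrite -(@ler_pXn2r _ 2) ?nnegrE// l2norm_sqr dot0l expr1n.
  exists 0 => _ [v _ <-].
  by rewrite -(@ler_pXn2r _ 2) ?nnegrE// outer u0 !dot0l expr0n mul0r.
have l0 : 0 < l2norm u.
  by rewrite lt_neqAle n0 andbT eq_sym -sqrf_eq0 l2norm_sqr dot_eq0.
have lE : dot u u = l2norm (u *m u^T *m ((l2norm u)^-1 *: u)).
  apply/eqP; rewrite -(@eqrXn2 _ 2) ?dot_ge0 ?n0// outer dotZr -l2norm_sqr.
  by apply/eqP; field; rewrite gt_eqF.
rewrite [X in X <= _]lE; apply: ub_le_sup.
  exists (dot u u) => _ [v /= v1 <-].
  rewrite -(@ler_pXn2r _ 2) ?nnegrE ?dot_ge0// outer expr2.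
  rewrite ler_wpM2l ?dot_ge0// (le_trans (cauchy_schwarz _ _))//.
  rewrite ler_piMr ?dot_ge0// -l2norm_sqr expr_le1//.
exists ((l2norm u)^-1 *: u) => //=.
rewrite -(@ler_pXn2r _ 2) ?nnegrE// l2norm_sqr dotZl dotZr -l2norm_sqr expr1n.
by rewrite [X in X <= _](_ : _ = 1) //; field; rewrite gt_eqF.
Qed.

End Dot.

(** * Diagonalization of real symmetric matrices *)

Lemma char_poly_block1 (R : comNzRingType) n (l : R) (A : 'M[R]_n) :
  char_poly (block_mx (l%:M : 'M[R]_1) 0 0 A) = ('X - l%:P) * char_poly A.
Proof.
rewrite /char_poly.
have -> : char_poly_mx (block_mx (l%:M : 'M[R]_1) 0 0 A) =
    block_mx ('X - l%:P)%:M 0 0 (char_poly_mx A).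
  rewrite /char_poly_mx (map_block_mx (@polyC R)).
  rewrite scalar_mx_block opp_block_mx add_block_mx !map_mx0 !oppr0 !addr0.
  by rewrite map_scalar_mx [in RHS]raddfB.
by rewrite det_ublock det_scalar1.
Qed.

Section Spectral.
Context {R : realType}.

Lemma is_spectrum_size n (A : 'M[R]_n) s : is_spectrum A s -> size s = n.
Proof.
move=> /(congr1 (fun q : {poly R} => size q)).
by rewrite size_char_poly size_prod_XsubC => -[].
Qed.

Lemma char_poly_conj n (A H : 'M[R]_n) : H *m H^T = 1%:M ->
  char_poly (H *m A *m H^T) = char_poly A.
Proof.
move=> HH; rewrite /char_poly.
pose K := map_mx (@polyC R) H.
have KT : K^T = map_mx (@polyC R) H^T by apply/matrixP => i j; rewrite !mxE.
have KK : K *m K^T = 1%:M by rewrite KT -map_mxM HH map_mx1.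
have -> : char_poly_mx (H *m A *m H^T) = K *m char_poly_mx A *m K^T.
  rewrite /char_poly_mx mulmxBr mulmxBl !map_mxM -KT; congr (_ - _).
  by rewrite mul_mx_scalar -scalemxAl KK scalemx1.
rewrite !det_mulmx mulrAC -det_mulmx KK det1 mul1r //.
Qed.

(** The reflection along [delta_mx 0 0 - v] is a symmetric involution that exchanges these two unit
    vectors, so its first row is [v]. *)
Lemma householder n (v : 'rV[R]_n.+1) : v *m v^T = 1%:M ->
  exists H : 'M[R]_n.+1, [/\ H^T = H, H *m H = 1%:M & row 0 H = v].
Proof.
move=> vv.
have [v0|ve] := eqVneq v (delta_mx 0 0).
  by exists 1%:M; rewrite trmx1 mulmx1 row1 v0.
have [w wE] : exists w : 'rV[R]_n.+1, w = delta_mx 0 0 - v by exists (delta_mx 0 0 - v).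
pose c : R := (w *m w^T) 0 0.
have wwE : w *m w^T = c%:M by rewrite [LHS]mx11_scalar.
have cdot : c = dot w^T w^T by rewrite /dot trmxK.
have c0 : c != 0 by rewrite cdot dot_eq0 trmx_eq0 wE subr_eq0 eq_sym.
(* Both vectors have unit length, so only their inner product enters. *)
have cE : c = 2 * (1 - v 0 0).
  rewrite cdot wE linearB /= trmx_delta dotDl !dotDr !dotNl !dotNr.
  rewrite (dotC v^T (delta_mx _ _)) !dot_delta !mxE eqxx /dot trmxK vv mxE eqxx /=.
  ring.
exists (1%:M - (2 / c) *: (w^T *m w)); split.
- by rewrite linearB linearZ /= trmx1 trmx_mul trmxK.
- rewrite mulmxBl mul1mx mulmxBr mulmx1 -scalemxAl -scalemxAr.
  rewrite -[w^T *m w *m _]mulmxA (mulmxA w) wwE mul_scalar_mx -scalemxAr !scalerA.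
  rewrite opprB addrA (_ : 2 / c * (2 / c * c) = 2 / c + 2 / c); last by field.
  by rewrite scalerDl !addrA addrK subrK.
rewrite rowE mulmxBr mulmx1 -scalemxAr mulmxA (mx11_scalar (delta_mx 0 0 *m w^T)).
rewrite mul_scalar_mx scalerA -rowE !mxE wE !mxE eqxx /= (_ : _ * _ = 1); last first.
  rewrite cE; field.
  by move: c0; rewrite cE mulf_eq0 negb_or => /andP[_].
by rewrite scale1r opprB addrC subrK.
Qed.

(** Induction by deflation. The head of [s] is a root of the characteristic polynomial, hence an
    eigenvalue; conjugating by a Householder matrix whose first row is a unit eigenvector splits it
    off, and the remaining symmetric block has the tail of [s] as spectrum. *)
Lemma sym_diagonalization n (A : 'M[R]_n) (s : seq R) :
  A^T = A -> is_spectrum A s ->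
  exists (U : 'M[R]_n) (d : 'rV[R]_n),
    [/\ U *m U^T = 1%:M, A = U^T *m diag_mx d *m U
      & perm_eq s [seq d 0 i | i : 'I_n]].
Proof.
elim: n A s => [|n IH] A s Asym As.
  exists 1%:M, 0; split; try by rewrite [LHS]flatmx0 [RHS]flatmx0.
  move: (is_spectrum_size As) => /size0nil ->.
  by rewrite (size0nil (_ : size [seq _ | i : 'I_0] = 0%N)) // size_map -cardE card_ord.
case: s As => [|l s] As; first by have := is_spectrum_size As.
have : root (char_poly A) l by rewrite As big_cons rootM root_XsubC eqxx.
rewrite -eigenvalue_root_char => /eigenvalueP[v0 v0A v0n0].
pose v := (Num.sqrt (dot v0^T v0^T))^-1 *: v0.
have q0 : 0 < dot v0^T v0^T by rewrite dot_gt0 trmx_eq0.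
have vv : v *m v^T = 1%:M.
  rewrite /v linearZ /= -scalemxAl -scalemxAr scalerA -invfM -expr2 sqr_sqrtr ?ltW//.
  rewrite [_ *m _]mx11_scalar (_ : (v0 *m v0^T) 0 0 = dot v0^T v0^T);
    last by rewrite /dot trmxK.
  by rewrite scale_scalar_mx mulVf ?gt_eqF.
have vA : v *m A = l *: v by rewrite /v -scalemxAl v0A !scalerA mulrC.
have [H [HT HH Hv]] := householder vv.
have [B BH] : exists B : 'M[R]_(1 + n), B = H *m A *m H by exists (H *m A *m H).
have BT : B^T = B by rewrite BH !trmx_mul Asym HT mulmxA.
(* The first row of [H] is an eigenvector and [H] is an involution, so the first row of [B] is [l]
   times a basis vector; symmetry then clears the first column. *)
have B0 j : B 0 j = l * (j == 0)%:R.
  transitivity ((row 0 B) 0 j); first by rewrite mxE.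
  rewrite BH !row_mul Hv vA -scalemxAl mxE; congr (_ * _).
  have : row 0 H *m H = delta_mx 0 0 by rewrite -row_mul HH row1.
  by rewrite Hv => ->; rewrite mxE eqxx.
pose A' := drsubmx B.
have ls0 : lshift n (0 : 'I_1) = 0 by apply/val_inj.
have BE : B = block_mx l%:M 0 0 A'.
  rewrite -[LHS]submxK; congr block_mx.
  - apply/matrixP => i j; rewrite !ord1 !mxE ls0 B0 eqxx mulr1 //.
  - apply/matrixP => i j; rewrite !ord1 !mxE ls0 B0 mulr0 //.
  - by apply/matrixP => i j; rewrite !ord1 !mxE ls0 -BT mxE B0 mulr0.
have A'T : A'^T = A' by rewrite /A' trmx_drsub BT.
have A's : is_spectrum A' s.
  have : char_poly B = char_poly A by rewrite BH -{2}HT char_poly_conj// HT.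
  rewrite As big_cons BE char_poly_block1.
  by apply: mulfI; rewrite polyXsubC_eq0.
have [U' [d' [UU Ad ps]]] := IH A' s A'T A's.
pose V : 'M[R]_(1 + n) := block_mx 1%:M 0 0 U'.
have VT : V^T = block_mx 1%:M 0 0 U'^T by rewrite /V tr_block_mx !trmx0 trmx1.
have VV : V *m V^T = 1%:M.
  rewrite VT /V mulmx_block.
  by rewrite !(mulmx0, mul0mx, mulmx1, addr0, add0r) UU -scalar_mx_block.
have BV : B = V^T *m diag_mx (row_mx l%:M d') *m V.
  rewrite diag_mx_row (_ : diag_mx _ = l%:M); last first.
    by apply/matrixP => i j; rewrite !ord1 !mxE.
  rewrite VT /V BE !mulmx_block.
  by rewrite !(mulmx0, mul0mx, mulmx1, mul1mx, addr0, add0r) -Ad.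
exists (V *m H), (row_mx l%:M d'); split.
- by rewrite trmx_mul HT mulmxA -(mulmxA V) HH mulmx1.
- rewrite trmx_mul HT !mulmxA -!(mulmxA H) mulmxA -BV BH.
  by rewrite !mulmxA HH mul1mx -mulmxA HH mulmx1.
rewrite /image_mem enum_ordSl /= -map_comp.
have -> : row_mx l%:M d' 0 0 = l.
  by rewrite -ls0 (row_mxEl (l%:M : 'M[R]_1)) mxE eqxx.
rewrite perm_cons (eq_map (_ : _ =1 (fun i => d' 0 i))) // => i /=.
rewrite -(row_mxEr (l%:M : 'M[R]_1) d' 0 i); congr (row_mx _ _ _ _).
exact/val_inj.
Qed.

Section Diagonalized.
Variables (n : nat) (A U : 'M[R]_n) (d : 'rV[R]_n).
Hypothesis UU : U *m U^T = 1%:M.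
Hypothesis AE : A = U^T *m diag_mx d *m U.

Lemma diag_dot_pres (u v : 'cV[R]_n) : dot (U *m u) (U *m v) = dot u v.
Proof. by rewrite dot_mulmx mulmxA (mulmx1C UU) mul1mx. Qed.

Lemma diag_expr k : A ^+ k = U^T *m diag_mx (\row_i d 0 i ^+ k) *m U.
Proof.
elim: k => [|k IH].
  rewrite expr0 (_ : \row_i _ = const_mx 1); last by apply/rowP => i; rewrite !mxE.
  by rewrite diag_const_mx mulmx1 (mulmx1C UU).
rewrite exprS IH {1}AE -mulmxE !mulmxA -(mulmxA _ U) UU mulmx1.
rewrite -[U^T *m _ *m _]mulmxA mulmx_diag; congr (_ *m diag_mx _ *m _).
by apply/rowP => i; rewrite !mxE exprS.
Qed.

Lemma diag_mxtrace k : \tr (A ^+ k) = \sum_i d 0 i ^+ k.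
Proof.
rewrite diag_expr mxtrace_mulC mulmxA UU mul1mx mxtrace_diag.
by apply: eq_bigr => i _; rewrite mxE.
Qed.

Lemma diag_quad k (v : 'cV[R]_n) :
  dot v (A ^+ k *m v) = \sum_i d 0 i ^+ k * (U *m v) i 0 ^+ 2.
Proof.
rewrite diag_expr -!mulmxA dot_mulmx trmxK dotE.
move: (U *m v) => y; apply: eq_bigr => i _.
by rewrite mul_diag_mx !mxE; ring.
Qed.

End Diagonalized.
End Spectral.

(** * Spectral bounds and the consensus gap *)

Lemma sorted_ge_nth (R : realType) (s : seq R) i j : sorted >=%R s ->
  (i <= j < size s)%N -> s`_j <= s`_i.
Proof.
move=> ss /andP[ij js].
apply: (sorted_leq_nth _ _ 0 ss) => //; last by rewrite inE (leq_ltn_trans ij).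
- by move=> a b c /= ba; move/le_trans; apply.
- by move=> a /=.
Qed.

Section SpectralConsequences.
Context {R : realType}.
Variables (n : nat) (A : 'M[R]_n) (s : seq R).
Hypotheses (Asym : A^T = A) (As : is_spectrum A s).

Lemma spectrum_mxtrace k : \tr (A ^+ k) = \sum_(m <- s) m ^+ k.
Proof.
have [U [d [UU AE sd]]] := sym_diagonalization Asym As.
by rewrite (diag_mxtrace UU AE) (perm_big _ sd) big_map big_enum.
Qed.

(** In eigencoordinates the form is a weighted sum of squares, and the even exponent makes each
    weight an even power of an absolute value. *)
Lemma spectrum_pow_le k (v : 'cV[R]_n) :
  dot v (A ^+ (2 * k) *m v) <=
  (\big[Num.max/0]_(m <- s) `|m|) ^+ (2 * k) * dot v v.
Proof.
have [U [d [UU AE sd]]] := sym_diagonalization Asym As.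
rewrite (diag_quad UU AE) -(diag_dot_pres UU) dotE mulr_sumr.
apply: ler_sum => i _; rewrite -expr2 ler_wpM2r ?sqr_ge0//.
rewrite !exprM lerXn2r ?nnegrE ?sqr_ge0//.
rewrite -[d 0 i ^+ 2]real_normK ?num_real// ler_pXn2r ?nnegrE//; last first.
  exact: bigmax_ge_id.
apply: (le_bigmax_seq _ (d 0 i) xpredT (fun m : R => `|m|)) => //.
by rewrite (perm_mem sd) map_f// mem_enum.
Qed.

Lemma rayleigh_ge l (v : 'cV[R]_n) : (forall m, m \in s -> l <= m) ->
  l * dot v v <= dot v (A *m v).
Proof.
move=> ls; have [U [d [UU AE sd]]] := sym_diagonalization Asym As.
have := diag_quad UU AE 1 v; rewrite expr1 => ->.
rewrite -(diag_dot_pres UU) dotE mulr_sumr.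
apply: ler_sum => i _; rewrite -expr2 expr1 ler_wpM2r ?sqr_ge0//.
by apply: ls; rewrite (perm_mem sd) map_f// mem_enum.
Qed.

Lemma spectrum_eigenvector m : m \in s ->
  exists2 v : 'cV[R]_n, v != 0 & A *m v = m *: v.
Proof.
move=> ms; have : root (char_poly A) m by rewrite As root_prod_XsubC.
rewrite -eigenvalue_root_char => /eigenvalueP[v vA v0].
exists v^T; first by rewrite trmx_eq0.
by rewrite -[A]Asym -trmx_mul vA linearZ.
Qed.

(** Evaluate the form at an eigenvector. This turns bounds on quadratic forms into bounds on
    eigenvalues. *)
Lemma spectrum_le c m : (forall v : 'cV[R]_n, dot v (A *m v) <= c * dot v v) ->
  m \in s -> m <= c.
Proof.
move=> Ac /spectrum_eigenvector[v v0 Av].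
by have := Ac v; rewrite Av dotZr ler_pM2r ?dot_gt0.
Qed.

Lemma spectrum_ge c m : (forall v : 'cV[R]_n, c * dot v v <= dot v (A *m v)) ->
  m \in s -> c <= m.
Proof.
move=> Ac /spectrum_eigenvector[v v0 Av].
by have := Ac v; rewrite Av dotZr ler_pM2r ?dot_gt0.
Qed.

End SpectralConsequences.

(** * Spectral gap of a doubly stochastic matrix on a connected graph *)

Section Consensus.
Context {R : realType}.
Variables (N : nat) (e : rel 'I_N) (W : 'M[R]_N).
Hypotheses (hW : doubly_stochastic W) (Wsym : W^T = W).

Lemma stochastic_const : W *m const_mx 1 = const_mx 1 :> 'cV[R]_N.
Proof.
have [_ W1 _] := hW; apply/colP => i; rewrite !mxE -[RHS](W1 i).
by apply: eq_bigr => j _; rewrite mxE mulr1.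
Qed.

(** Expand the square: unit row sums and unit column sums turn the two pure terms into [dot v v]
    each. The right side is visibly nonnegative and shows when it vanishes. *)
Lemma laplacian_quad (v : 'cV[R]_N) :
  dot v v - dot v (W *m v) = 2^-1 * \sum_i \sum_j W i j * (v i 0 - v j 0) ^+ 2.
Proof.
have [_ W1 W2] := hW.
have E1 : \sum_i \sum_j W i j * v i 0 ^+ 2 = dot v v.
  by rewrite dotE; apply: eq_bigr => i _; rewrite -mulr_suml W1 mul1r expr2.
have E2 : \sum_i \sum_j W i j * v j 0 ^+ 2 = dot v v.
  rewrite exchange_big dotE; apply: eq_bigr => i _.
  by rewrite -mulr_suml W2 mul1r expr2.
have E3 : \sum_i \sum_j W i j * (v i 0 * v j 0) = dot v (W *m v).
  rewrite dotE; apply: eq_bigr => i _; rewrite mxE mulr_sumr.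
  by apply: eq_bigr => j _; ring.
rewrite (_ : \sum_i _ = dot v v + dot v v - 2 * dot v (W *m v)); first by field.
rewrite -{1}E1 -E2 -E3 mulr_sumr -big_split -sumrB; apply: eq_bigr => i _ /=.
by rewrite mulr_sumr -big_split -sumrB; apply: eq_bigr => j _ /=; ring.
Qed.

Lemma stochastic_le (v : 'cV[R]_N) : dot v (W *m v) <= dot v v.
Proof.
have [W0 _ _] := hW.
rewrite -subr_ge0 laplacian_quad mulr_ge0// sumr_ge0// => i _.
by rewrite sumr_ge0// => j _; rewrite mulr_ge0// sqr_ge0.
Qed.

Hypotheses (he : connected_graph e) (hWe : compatible_with_graph e W).

(** The Laplacian form vanishes at a fixed vector, so each of its nonnegative terms does; positive
    weights force equality across edges, and a path carries it from [i] to [j]. *)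
Lemma fixed_const (v : 'cV[R]_N) i j : W *m v = v -> v i 0 = v j 0.
Proof.
move=> Wv; have [W0 _ _] := hW; have [esym eirr econ] := he.
have [_ We] := hWe.
have /eqP := laplacian_quad v.
rewrite Wv subrr eq_sym mulf_eq0 invr_eq0 pnatr_eq0 /= => /eqP v0.
have step k l : e k l -> v k 0 = v l 0.
  move=> ekl; have kl : k != l by apply: contraTneq ekl => ->; rewrite eirr.
  have : W k l * (v k 0 - v l 0) ^+ 2 = 0.
    have pos i' j' : 0 <= W i' j' * (v i' 0 - v j' 0) ^+ 2.
      by rewrite mulr_ge0// sqr_ge0.
    have vk : \sum_j W k j * (v k 0 - v j 0) ^+ 2 = 0.
      by apply: (psumr_eq0P _ v0) => // i' _; apply: sumr_ge0.
    by apply: (psumr_eq0P _ vk) => // j' _; apply: pos.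
  move/eqP; rewrite mulf_eq0 gt_eqF/=; last exact: (We k l kl).1.
  by rewrite sqrf_eq0 subr_eq0 => /eqP.
have /connectP[q] := econ i j.
elim: q i => [|k q IH] i /= => [_ -> //|/andP[eik ek] jE].
by rewrite (step _ _ eik); exact: IH.
Qed.

Variable lam : N.-tuple R.
Hypotheses (hN : (1 < N)%N) (Wlam : is_spectrum W lam).
Hypothesis lam_sorted : sorted >=%R lam.

Lemma spectrum_ge_last m : m \in (lam : seq R) -> lam`_N.-1 <= m.
Proof.
move=> ml; rewrite -(nth_index 0 ml).
have il : (index m lam < N)%N by rewrite -[X in (_ < X)%N](size_tuple lam) index_mem.
apply: sorted_ge_nth => //; rewrite size_tuple ltn_predL (ltnW hN) andbT.
by rewrite -ltnS prednK// ltnW.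
Qed.

(** In an orthonormal eigenbasis, the eigenvalue 1 is the largest, is simple by connectivity, and so
    occupies position 0 of [lam]. A vector orthogonal to the constants has no component along it,
    and every other eigenvalue is at most the entry at position 1. *)
Lemma consensus_gap : lam`_1 < 1 /\
  forall v : 'cV[R]_N, dot (const_mx 1) v = 0 ->
    dot v (W *m v) <= lam`_1 * dot v v.
Proof.
have [U [d [UU WE sd]]] := sym_diagonalization Wsym Wlam.
have dlam i : d 0 i \in (lam : seq R) by rewrite (perm_mem sd) map_f// mem_enum.
have lam_le1 m : m \in (lam : seq R) -> m <= 1.
  by apply: (spectrum_le Wsym Wlam) => v; rewrite mul1r stochastic_le.
have DU : diag_mx d *m U = U *m W by rewrite WE !mulmxA UU mul1mx.
pose one : 'cV[R]_N := const_mx 1.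
have one0 : one != 0.
  apply/eqP => /colP/(_ (Ordinal (ltnW hN))); rewrite !mxE => /eqP.
  by rewrite oner_eq0.
(* Eigencoordinates of the constant vector: as [W] fixes that vector, they vanish wherever the
   eigenvalue differs from 1. *)
pose u := U *m one.
have du i : d 0 i * u i 0 = u i 0.
  have : (diag_mx d *m u) i 0 = u i 0 by rewrite /u mulmxA DU -mulmxA stochastic_const.
  by rewrite mul_diag_mx mxE.
(* Eigenvectors for the eigenvalue 1 are constant, so two orthonormal ones
   cannot exist. *)
have uniq1 i j : d 0 i = 1 -> d 0 j = 1 -> i = j.
  move=> di dj; apply/eqP; apply: contraT => ij.
  pose z (i : 'I_N) : 'cV[R]_N := U^T *m delta_mx i 0.
  have zW k : d 0 k = 1 -> W *m z k = z k.
    move=> dk; rewrite /z WE -!mulmxA (mulmxA U) UU mul1mx; congr (_ *m _).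
    rewrite mul_diag_mx; apply/colP => l; rewrite !mxE.
    by case: eqP => [->|]; rewrite ?dk ?mul1r ?mulr0.
  have zz k l : dot (z k) (z l) = (k == l)%:R.
    by rewrite /z dot_mulmx trmxK mulmxA UU mul1mx dot_delta mxE eqxx andbT.
  pose o := Ordinal (ltnW hN).
  have zc k : d 0 k = 1 -> z k = z k o 0 *: one.
    move=> dk; apply/colP => l; rewrite !mxE mulr1.
    have := fixed_const l o (zW _ dk); by rewrite !mxE.
  have := zz i j; rewrite (zc i di) (zc j dj) dotZl dotZr (negbTE ij) => /eqP.
  rewrite !mulf_eq0 dot_eq0 (negbTE one0) orbF => /orP[] /eqP z0.
    have := zz i i; rewrite (zc i di) z0 scale0r dot0l eqxx => /eqP.
    by rewrite eq_sym oner_eq0.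
  have := zz j j; rewrite (zc j dj) z0 scale0r dot0l eqxx => /eqP.
    by rewrite eq_sym oner_eq0.
have [i0 ui0] : exists i, u i 0 != 0.
  apply/existsP; apply: contraT => /existsPn u0.
  have : dot u u = 0.
    by rewrite dotE big1// => i _; have := u0 i; rewrite negbK => /eqP ->; rewrite mul0r.
  by rewrite diag_dot_pres// => /eqP; rewrite dot_eq0 (negbTE one0).
have di0 : d 0 i0 = 1.
  by apply: (mulIf ui0); rewrite du mul1r.
have lam01 : lam`_0 = 1.
  have m0 : lam`_0 \in (lam : seq R) by rewrite mem_nth// size_tuple ltnW.
  apply/eqP; rewrite eq_le lam_le1//=.
  have := dlam i0; rewrite di0 => ml; rewrite -(nth_index 0 ml).
  by apply: sorted_ge_nth => //; rewrite index_mem.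
(* If the entry at position 1 were also 1, the value 1 would be counted twice, giving two distinct
   indices against [uniq1]. *)
have lam1n : lam`_1 != 1.
  apply/eqP => lam11.
  have : (2 <= count_mem 1%R lam)%N.
    case: (tval lam) lam01 lam11 (size_tuple lam) => [|a [|b t]] /=.
    - by move=> _ _ E; move: hN; rewrite -E.
    - by move=> _ _ E; move: hN; rewrite -E.
    - by move=> -> -> _; rewrite eqxx.
  rewrite (permP sd) count_map -size_filter; set f := seq.filter _ _ => c2.
  have fu : uniq f by rewrite filter_uniq ?enum_uniq.
  have f1 i : i \in f -> d 0 i = 1 by rewrite mem_filter => /andP[/eqP].
  clearbody f; case: f c2 fu f1 => [|i [|j t]] //= _.
  rewrite inE negb_or => /andP[/andP[/eqP ij _] _] f1.
  by apply: ij; apply: uniq1; apply: f1; rewrite !inE eqxx ?orbT.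
split; first by rewrite lt_neqAle lam1n lam_le1// mem_nth// size_tuple.
move=> v v1; have := diag_quad UU WE 1 v; rewrite expr1 => ->.
rewrite -(diag_dot_pres UU) dotE mulr_sumr.
apply: ler_sum => i _; rewrite -expr2 expr1.
(* Orthogonality to the constants kills the coordinate at [i0], because [u] is supported at [i0]
   alone. *)
have [->|ii0] := eqVneq i i0.
  have : dot u (U *m v) = 0 by rewrite diag_dot_pres.
  rewrite dotE (bigD1 i0)//= big1 ?addr0 => [/eqP|j ji0].
    by rewrite mulf_eq0 (negbTE ui0) => /eqP ->; rewrite expr0n !mulr0.
  have [->|uj] := eqVneq (u j 0) 0; first by rewrite mul0r.
  have dj : d 0 j = 1 by apply: (mulIf uj); rewrite du mul1r.
  by move: ji0; rewrite (uniq1 _ _ dj di0) eqxx.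
rewrite ler_wpM2r ?sqr_ge0// -(nth_index 0 (dlam i)).
apply: sorted_ge_nth => //; rewrite index_mem dlam andbT.
(* Position 0 holds the value 1, which by [uniq1] belongs to [i0] only. *)
rewrite lt0n; apply: contra_neq ii0 => i0i; apply: uniq1 => //.
by rewrite -(nth_index 0 (dlam i)) i0i.
Qed.

End Consensus.

(** * Blocks, slices and quadratic functions *)

Section Blocks.
Context {R : realType} {N d : nat}.

(** One coordinate across all nodes. The Kronecker product with the identity acts on each slice as
    [W], just as [block_diag] acts separately on each block. *)
Definition slice (x : 'cV[R]_(N * d)) (s : 'I_d) : 'cV[R]_N :=
  \col_i x (mxtens_index (i, s)) 0.

Lemma big_mxtens (F : 'I_(N * d) -> R) :
  \sum_a F a = \sum_i \sum_s F (mxtens_index (i, s)).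
Proof.
rewrite pair_big (reindex (@mxtens_index N d)) /=; last first.
  by exists (@mxtens_unindex N d) => a _; rewrite ?mxtens_indexK ?mxtens_unindexK.
by apply: eq_bigr => -[].
Qed.

Lemma dot_block (x y : 'cV[R]_(N * d)) :
  dot x y = \sum_i dot (block x i) (block y i).
Proof.
rewrite dotE big_mxtens; apply: eq_bigr => i _; rewrite dotE.
by apply: eq_bigr => s _; rewrite !mxE.
Qed.

Lemma dot_slice (x y : 'cV[R]_(N * d)) :
  dot x y = \sum_s dot (slice x s) (slice y s).
Proof.
rewrite dotE big_mxtens exchange_big; apply: eq_bigr => s _; rewrite dotE.
by apply: eq_bigr => i _; rewrite !mxE.
Qed.

Lemma block_stack (v : 'I_N -> 'cV[R]_d) i : block (stack v) i = v i.
Proof. by apply/colP => s; rewrite !mxE mxtens_indexK. Qed.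

Lemma blockDZ (x y : 'cV[R]_(N * d)) a i :
  block (x + a *: y) i = block x i + a *: block y i.
Proof. by apply/colP => s; rewrite !mxE. Qed.

Lemma blockB (x y : 'cV[R]_(N * d)) i : block (x - y) i = block x i - block y i.
Proof. by apply/colP => s; rewrite !mxE. Qed.

Lemma block_diag_mulmx (Q : 'I_N -> 'M[R]_d) (x : 'cV[R]_(N * d)) i :
  block (block_diag Q *m x) i = Q i *m block x i.
Proof.
apply/colP => s; rewrite !mxE big_mxtens (bigD1 i)//= [X in _ + X]big1 ?addr0 => [|j ji].
  apply: eq_bigr => s' _; rewrite mxE; congr (_ * _).
  rewrite /block_diag summxE (bigD1 i)//= big1 ?addr0 => [|j ji].
    by rewrite tensmxE mxE !eqxx mul1r.
  by rewrite tensmxE mxE eq_sym (negbTE ji) mul0r.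
rewrite big1// => s' _; rewrite /block_diag summxE big1 ?mul0r// => k _.
rewrite tensmxE mxE; case: eqP => [<-|]; last by rewrite mul0r.
by rewrite (negbTE ji) mul0r.
Qed.

Lemma slice_kron (W : 'M[R]_N) (x : 'cV[R]_(N * d)) s :
  slice ((W *t (1%:M : 'M[R]_d)) *m x) s = W *m slice x s.
Proof.
apply/colP => i; rewrite !mxE big_mxtens; apply: eq_bigr => j _.
rewrite (bigD1 s)//= big1 ?addr0 => [|s' ss'].
  by rewrite tensmxE !mxE eqxx mulr1.
by rewrite tensmxE !mxE eq_sym (negbTE ss') mulr0 mul0r.
Qed.

Lemma sliceB (x y : 'cV[R]_(N * d)) s : slice (x - y) s = slice x s - slice y s.
Proof. by apply/colP => i; rewrite !mxE. Qed.

Lemma sliceZ a (x : 'cV[R]_(N * d)) s : slice (a *: x) s = a *: slice x s.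
Proof. by apply/colP => i; rewrite !mxE. Qed.

Lemma slice_const (v : 'cV[R]_d) s :
  slice (stack (fun _ : 'I_N => v)) s = v s 0 *: const_mx 1.
Proof. by apply/colP => i; rewrite !mxE mxtens_indexK mulr1. Qed.

End Blocks.

(** * Quadratic functions and their gradients *)

Section Quadratic.
Context {R : realType}.

Lemma quadE n (Q : 'M[R]_n) (p : 'cV[R]_n) r x :
  quad Q p r x = 2^-1 * dot x (Q *m x) - dot p x + r.
Proof. by rewrite /quad /dot mulmxA. Qed.

Lemma quad_expand n (Q : 'M[R]_n) (p : 'cV[R]_n) r x v : Q^T = Q ->
  quad Q p r (x + v) =
  quad Q p r x + dot v (Q *m x - p) + 2^-1 * dot v (Q *m v).
Proof.
move=> Qs; have xv : dot x (Q *m v) = dot v (Q *m x).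
  by rewrite dot_mulmx Qs dotC.
rewrite !quadE mulmxDr dotDl !dotDr dotNr xv (dotC p v).
by field.
Qed.

Lemma loewner_ge n (Q : 'M[R]_n) mu v : loewner_le mu%:M Q ->
  mu * dot v v <= dot v (Q *m v).
Proof.
move=> [_ /(_ v)]; rewrite -mulmxA -/(dot _ _) mulmxBl dotDr dotNr mul_scalar_mx.
by rewrite dotZr subr_ge0.
Qed.

Lemma loewner_le_quad n (Q : 'M[R]_n) L v : loewner_le Q L%:M ->
  dot v (Q *m v) <= L * dot v v.
Proof.
move=> [_ /(_ v)]; rewrite -mulmxA -/(dot _ _) mulmxBl dotDr dotNr mul_scalar_mx.
by rewrite dotZr subr_ge0.
Qed.

(* Compare the lower bound [m] with the value after one gradient step of
   size [1 / L]. *)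
Lemma quad_descent n (Q : 'M[R]_n) (p : 'cV[R]_n) r L m x :
  0 < L -> Q^T = Q -> (forall v, dot v (Q *m v) <= L * dot v v) ->
  (forall y, m <= quad Q p r y) ->
  dot (Q *m x - p) (Q *m x - p) <= 2 * L * (quad Q p r x - m).
Proof.
move=> L0 Qs QL mQ; set g := Q *m x - p.
have := mQ (x + (- L^-1) *: g); rewrite quad_expand// -/g -scalemxAr !dotZl dotZr.
have := QL g; move: (dot g g) (dot g (Q *m g)) (quad Q p r x) => gg gQ q gQL mq.
(* Scaling by [L * L] clears the inverses of [L]. *)
have : L * L * m <= L * L * (q - L^-1 * gg + 2^-1 * (L^-1 * (L^-1 * gQ))).
  apply: ler_wpM2l; first by apply: mulr_ge0; exact: ltW.
  by move: mq; rewrite !mulNr mulrN opprK.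
rewrite (_ : L * L * (q - _ + _) = L * L * q - L * gg + 2^-1 * gQ); last first.
  by field; rewrite gt_eqF.
move=> H; have : L * gg <= L * (2 * L * (q - m)) by lra.
by rewrite ler_pM2l.
Qed.

(** For nonzero [h] the difference quotient is exactly [a + h * b]. *)
Lemma derive_quadratic n (f : 'cV[R]_n -> R) (x v : 'cV[R]_n) (a b : R) :
  (forall h : R, f (x + h *: v) = f x + h * a + h ^+ 2 * b) -> 'D_v f x = a.
Proof.
move=> fE; rewrite /derive; apply: cvg_lim => //.
have lin : (fun h : R => a + h * b) @ 0^' --> a.
  rewrite -[X in _ --> X](_ : a + 0 * b = a); last by rewrite mul0r addr0.
  apply: cvg_within_filter.
  by apply: cvgD; [exact: cvg_cst | apply: cvgM; [exact: cvg_id | exact: cvg_cst]].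
apply: cvg_trans lin; apply: near_eq_cvg; near=> h.
have h0 : h != 0 by near: h; exact: nbhs_dnbhs_neq.
rewrite /= (addrC _ x) fE /GRing.scale /=; field; exact: h0.
Unshelve. all: by end_near.
Qed.

(** Along a coordinate direction the objective is an exact quadratic in [h], and its linear
    coefficient is read off blockwise. *)
Lemma grad_separable_quad N d (Q : 'I_N -> 'M[R]_d) (p : 'I_N -> 'cV[R]_d)
    (r : 'I_N -> R) x : (forall i, (Q i)^T = Q i) ->
  grad (separable_sum (fun i => quad (Q i) (p i) (r i))) x =
  block_diag Q *m x - stack p.
Proof.
move=> Qs; apply/colP => a; rewrite mxE.
set v := delta_mx a 0.
have -> : (block_diag Q *m x - stack p) a 0 = dot v (block_diag Q *m x - stack p).
  by rewrite dot_delta.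
apply: (@derive_quadratic _ _ _ _ _ (2^-1 * dot v (block_diag Q *m v))) => h.
rewrite /separable_sum !dot_block !mulr_sumr -!big_split /=.
apply: eq_bigr => i _.
rewrite blockDZ quad_expand// -scalemxAr !dotZl dotZr.
rewrite blockB !block_diag_mulmx block_stack; ring.
Qed.

End Quadratic.

(** * The recursion and the bias of its fixed point *)

Section Decentralized.
Context {R : realType}.
Variables (N d : nat) (mu L : R).
Hypotheses (hN : (1 < N)%N) (hmu : 0 < mu) (hmuL : mu <= L).
Variables (Q : 'I_N -> 'M[R]_d) (p : 'I_N -> 'cV[R]_d) (r : 'I_N -> R).
Hypotheses (hQsym : forall i, (Q i)^T = Q i)
  (hQmu : forall i, loewner_le mu%:M (Q i))
  (hQL : forall i, loewner_le (Q i) L%:M).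
Variables (e : rel 'I_N) (W : 'M[R]_N).
Hypotheses (he : connected_graph e) (hWsym : W^T = W)
  (hW : doubly_stochastic W) (hWe : compatible_with_graph e W).
Variable lam : N.-tuple R.
Hypotheses (hlam : is_spectrum W lam) (lam_sorted : sorted >=%R lam).
Variables (alpha : R).
Hypothesis halpha : 0 < alpha.

Local Notation WI := (W *t (1%:M : 'M[R]_d)).
Local Notation AQ := (WI - alpha *: block_diag Q).
Local Notation G x := (block_diag Q *m x - stack p).
Local Notation f i := (quad (Q i) (p i) (r i)).

Let L0 : 0 < L.
Proof. exact: lt_le_trans hmu hmuL. Qed.

Lemma block_diag_sym : (block_diag Q)^T = block_diag Q.
Proof.
rewrite /block_diag raddf_sum; apply: eq_bigr => i _ /=.
by rewrite trmx_tens trmx_delta hQsym.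
Qed.

Lemma AQ_sym : AQ^T = AQ.
Proof.
by rewrite linearB linearZ /= trmx_tens hWsym trmx1 block_diag_sym.
Qed.

Lemma block_diag_quad_le (v : 'cV[R]_(N * d)) :
  dot v (block_diag Q *m v) <= L * dot v v.
Proof.
rewrite !dot_block mulr_sumr; apply: ler_sum => i _.
by rewrite block_diag_mulmx loewner_le_quad.
Qed.

Lemma block_diag_quad_ge (v : 'cV[R]_(N * d)) :
  mu * dot v v <= dot v (block_diag Q *m v).
Proof.
rewrite !dot_block mulr_sumr; apply: ler_sum => i _.
by rewrite block_diag_mulmx loewner_ge.
Qed.

Lemma WI_le (v : 'cV[R]_(N * d)) : dot v (WI *m v) <= dot v v.
Proof.
rewrite !dot_slice; apply: ler_sum => s _.
by rewrite slice_kron stochastic_le.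
Qed.

Lemma WI_ge (v : 'cV[R]_(N * d)) : lam`_N.-1 * dot v v <= dot v (WI *m v).
Proof.
rewrite !dot_slice mulr_sumr; apply: ler_sum => s _; rewrite slice_kron.
by apply: (rayleigh_ge hWsym hlam) => m; exact: spectrum_ge_last.
Qed.

(** Upper side: [W] is at most the identity and [Q] at least [mu]. Lower side: eigenvalues are at
    least [lamN - alpha * L], with [lamN] the last entry of [lam], and the stepsize condition says
    precisely that this is at least [- (1 - alpha * mu)]. *)
Lemma AQ_spectrum_le (s : seq R) : is_spectrum AQ s ->
  alpha <= (1 + lam`_N.-1) / (L + mu) ->
  \big[Num.max/0]_(m <- s) `|m| <= 1 - alpha * mu.
Proof.
move=> As; rewrite ler_pdivlMr ?addr_gt0// => aL.
have dotA (v : 'cV[R]_(N * d)) :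
    dot v (AQ *m v) = dot v (WI *m v) - alpha * dot v (block_diag Q *m v).
  by rewrite mulmxBl dotDr dotNr -scalemxAl dotZr.
have upper m : m \in s -> m <= 1 - alpha * mu.
  apply: (spectrum_le AQ_sym As) => v; rewrite dotA mulrBl mul1r.
  by rewrite lerB ?WI_le// -mulrA ler_wpM2l ?(ltW halpha)// block_diag_quad_ge.
have lower m : m \in s -> - (1 - alpha * mu) <= m.
  apply: (spectrum_ge AQ_sym As) => v; rewrite dotA.
  apply: (@le_trans _ _ (lam`_N.-1 * dot v v - alpha * (L * dot v v))).
    by rewrite mulrA -mulrBl ler_wpM2r ?dot_ge0//; lra.
  by rewrite lerB ?WI_ge// ler_wpM2l ?(ltW halpha)// block_diag_quad_le.
have abs m : m \in s -> `|m| <= 1 - alpha * mu.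
  by move=> ms; rewrite ler_norml upper// lower.
(* The maximum starts from 0, so [1 - alpha * mu] must be shown nonnegative: the last eigenvalue is
   at most 1 and [2 * mu <= L + mu]. *)
rewrite big_seq; apply: bigmax_le => //.
have lamN1 : lam`_N.-1 <= 1.
  apply: (@spectrum_le _ _ _ lam hWsym hlam 1); last first.
    by rewrite mem_nth// size_tuple ltn_predL (ltnW hN).
  by move=> v; rewrite mul1r stochastic_le.
have : alpha * (2 * mu) <= alpha * (L + mu)
  by rewrite ler_wpM2l ?(ltW halpha)//; have := hmuL; lra.
lra.
Qed.

Variable xinf : 'cV[R]_(N * d).
Hypothesis hxinf : (1%:M - WI) *m xinf + alpha *: G xinf = 0.

(** Subtracting the fixed-point equation cancels [stack p] and leaves a linear recursion. The noise
    of index [j] enters at step [j] and is then propagated by the [k - j.+1] remaining steps. *)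
Lemma dsg_error (x0 : 'cV[R]_(N * d)) noise k :
  dsg W alpha (fun x => G x) x0 noise k - xinf =
  AQ ^+ k *m (x0 - xinf)
  - alpha *: \sum_(j < k) (AQ ^+ (k - j.+1) *m noise j).
Proof.
have fix_xinf : xinf = WI *m xinf - alpha *: G xinf.
  have /eqP := hxinf; rewrite mulmxBl mul1mx addrAC subr_eq0 => /eqP <-.
  by rewrite addrK.
elim: k => [|k IH]; first by rewrite expr0 mul1mx big_ord0 scaler0 subr0.
have step : dsg W alpha (fun x => G x) x0 noise k.+1 - xinf =
    AQ *m (dsg W alpha (fun x => G x) x0 noise k - xinf) - alpha *: noise k.
  rewrite [dsg _ _ _ _ _ k.+1]/= {1}fix_xinf.
  move: (dsg _ _ _ _ _ k) => y.
  rewrite mulmxBl !mulmxBr -!scalemxAl !scalerDr !scalerN.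
  apply/colP => a; rewrite !mxE; ring.
rewrite step IH big_ord_recr /= subnn expr0 mul1mx scalerDr opprD addrA.
congr (_ - _); rewrite mulmxBr mulmxA mulmxE -exprS -scalemxAr; congr (_ - _ *: _).
rewrite mulmx_sumr; apply: eq_bigr => j _.
by rewrite mulmxA mulmxE -exprS subnS prednK ?subn_gt0// subSn// ltnW.
Qed.

(** * Distance from the fixed point to the optimum *)

Section Bias.
Variables (xopt : 'cV[R]_d) (fstar : 'I_N -> R).
Hypothesis hfstar : forall i x, fstar i <= f i x.
Hypothesis hxopt : is_minimizer (average (fun i => f i)) xopt.

Let xbar : 'cV[R]_d := \col_s (N%:R^-1 * \sum_i xinf (mxtens_index (i, s)) 0).
Let y := xinf - stack (fun _ => xbar).

Let N0 : 0 < N%:R :> R. Proof. by rewrite ltr0n ltnW. Qed.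

Lemma fixed_point_slice s :
  slice xinf s - W *m slice xinf s = - alpha *: slice (G xinf) s.
Proof.
rewrite -slice_kron -sliceB -sliceZ; congr slice; apply/eqP.
by rewrite scaleNr -addr_eq0 -[X in X - _]mul1mx -mulmxBl hxinf.
Qed.

Lemma dot_slice_centered s : dot (const_mx 1) (slice y s) = 0.
Proof.
rewrite /y sliceB slice_const dotDr dotNr dotZr !dotE mxE.
under eq_bigr do rewrite !mxE mul1r.
under [X in _ - _ * X]eq_bigr do rewrite !mxE mul1r.
by rewrite sumr_const card_ord mulrAC mulVf ?gt_eqF// mul1r subrr.
Qed.

(** The operator [1%:M - WI] kills consensus vectors, so it takes the same value at [y] and at
    [xinf], where the fixed-point equation gives it; pair with [y]. *)
Lemma centered_quad : dot y y - dot y (WI *m y) = - alpha * dot y (G xinf).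
Proof.
rewrite !dot_slice -sumrB mulr_sumr; apply: eq_bigr => s _.
rewrite slice_kron -dotNr -dotDr -dotZr -fixed_point_slice; congr dot.
rewrite /y sliceB slice_const mulmxBr -scalemxAr stochastic_const//.
by rewrite opprB addrA subrK.
Qed.

(** Write [g] for the gradient and [c] for the gap. The gap gives [c |y|^2 <= - alpha y.g];
    expanding [|c y + alpha g|^2 >= 0] then yields the bound without square roots. *)
Lemma consensus_error :
  (1 - lam`_1) ^+ 2 * dot y y <= alpha ^+ 2 * dot (G xinf) (G xinf).
Proof.
have [lam1 gap] := consensus_gap hW hWsym he hWe hN hlam lam_sorted.
have yW : dot y (WI *m y) <= lam`_1 * dot y y.
  rewrite !dot_slice mulr_sumr; apply: ler_sum => s _; rewrite slice_kron.
  by apply: gap; exact: dot_slice_centered.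
move: (centered_quad) yW; move: y (G xinf) => z g zE zW.
have := dot_ge0 ((1 - lam`_1) *: z + alpha *: g).
rewrite dotDl !dotDr !dotZl !dotZr (dotC g z).
move: (dot z z) (dot z (WI *m z)) (dot g g) (dot z g) zW zE.
move=> yy yWy gg yg yW yE H.
have : (1 - lam`_1) * ((1 - lam`_1) * yy) <= (1 - lam`_1) * (- alpha * yg).
  by apply: ler_wpM2l; [rewrite subr_ge0 ltW | lra].
move: H; rewrite !expr2; nra.
Qed.

(** Pairing the fixed-point equation with [xinf] makes the gradient point against it, so by
    convexity the objective at [xinf] is at most its value at 0. The descent inequality at each node
    converts this into a gradient bound. *)
Lemma gradient_bound :
  dot (G xinf) (G xinf) <= 2 * L * \sum_i (f i 0 - fstar i).
Proof.
have xG : dot xinf (G xinf) <= 0.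
  have := WI_le xinf; rewrite -subr_ge0 -dotNr -dotDr.
  have -> : xinf - WI *m xinf = - alpha *: G xinf.
    by apply/eqP; rewrite scaleNr -addr_eq0 -[X in X - _]mul1mx -mulmxBl hxinf.
  by rewrite dotZr mulNr oppr_ge0 pmulr_rle0.
rewrite dot_block mulr_sumr.
apply: (@le_trans _ _ (\sum_i 2 * L * (f i (block xinf i) - fstar i))).
  apply: ler_sum => i _; rewrite blockB block_diag_mulmx block_stack.
  by apply: quad_descent => // v; exact: loewner_le_quad.
rewrite -!mulr_sumr ler_wpM2l ?mulr_ge0 ?(ltW L0)// -subr_ge0 -sumrB.
apply: (@le_trans _ _ (- dot xinf (G xinf))); first by rewrite oppr_ge0.
rewrite dot_block -sumrN; apply: ler_sum => i _.
have := quad_expand (p i) (r i) (block xinf i) (- block xinf i) (hQsym i).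
rewrite subrr => ->.
rewrite blockB block_diag_mulmx block_stack !dotNl mulmxN dotNr opprK.
have : 0 <= dot (block xinf i) (Q i *m block xinf i).
  by apply: le_trans (loewner_ge _ (hQmu i)); rewrite mulr_ge0 ?dot_ge0 ?(ltW hmu).
lra.
Qed.

(** A symmetric stochastic [W] preserves coordinate sums, so summing the fixed-point equation over
    nodes leaves only [alpha] times the gradients. *)
Lemma fixed_point_gradient_sum : \sum_i (Q i *m block xinf i - p i) = 0.
Proof.
apply/colP => s; rewrite summxE mxE.
transitivity (dot (const_mx 1) (slice (G xinf) s)).
  rewrite dotE; apply: eq_bigr => i _.
  by rewrite -block_diag_mulmx !mxE mxtens_indexK /= mul1r.
apply: (@mulfI _ (- alpha)); first by rewrite oppr_eq0 gt_eqF.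
rewrite mulr0 -dotZr -fixed_point_slice dotDr dotNr dot_mulmx hWsym.
by rewrite stochastic_const// subrr.
Qed.

(** The average is again a quadratic, with averaged data and the same bound [L]. The descent
    inequality with its minimum as lower bound makes the squared gradient nonpositive. *)
Lemma minimizer_gradient_sum : \sum_i (Q i *m xopt - p i) = 0.
Proof.
pose Qa := N%:R^-1 *: \sum_i Q i; pose pa := N%:R^-1 *: \sum_i p i.
pose ra := N%:R^-1 * \sum_i r i.
have Qmul (v : 'cV[R]_d) : Qa *m v = N%:R^-1 *: \sum_i (Q i *m v).
  by rewrite /Qa -scalemxAl mulmx_suml.
have avgE x : average (fun i => f i) x = quad Qa pa ra x.
  rewrite quadE Qmul dotZr dot_sumr (dotC pa) /pa dotZr dot_sumr /ra /average.
  rewrite mulrCA -mulrBr -mulrDr; congr (_ * _).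
  rewrite mulr_sumr -sumrB -big_split /=; apply: eq_bigr => i _.
  by rewrite quadE (dotC (p i)).
have QaT : Qa^T = Qa.
  by rewrite /Qa linearZ /= raddf_sum; congr (_ *: _); apply: eq_bigr => i _ /=.
have QaL v : dot v (Qa *m v) <= L * dot v v.
  rewrite Qmul dotZr dot_sumr ler_pdivrMl// mulrCA mulr_natl.
  rewrite -[X in _ *+ X]card_ord -sumr_const mulr_sumr.
  by apply: ler_sum => i _; exact: loewner_le_quad.
have : dot (Qa *m xopt - pa) (Qa *m xopt - pa) <= 0.
  apply: le_trans (quad_descent (m := quad Qa pa ra xopt) (r := ra) _ L0 QaT QaL _) _.
    by move=> z; rewrite -!avgE.
  by rewrite subrr mulr0.
rewrite le_eqVlt ltNge dot_ge0 orbF dot_eq0 Qmul /pa -scalerBr scaler_eq0.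
rewrite invr_eq0 gt_eqF//= => /eqP QP; by rewrite sumrB QP.
Qed.

(** The difference of the two vanishing gradient sums is the sum of the [Q i *m (block y i + z)].
    Testing it against [z] bounds the form in [z] by the form in [y]; then use the lower bound [mu]
    for the former and the upper bound [L] for the latter. *)
Lemma mean_error :
  mu * N%:R * dot (xbar - xopt) (xbar - xopt) <= L * dot y y.
Proof.
set z := xbar - xopt.
have yE i : block y i + z = block xinf i - xopt.
  by rewrite /y /z blockB block_stack addrA subrK.
have sum0 : \sum_i dot z (Q i *m (block y i + z)) = 0.
  rewrite -dot_sumr [X in dot z X](_ : _ = 0) ?dot0r//.
  transitivity (\sum_i (Q i *m block xinf i - p i) - \sum_i (Q i *m xopt - p i)).
    rewrite -sumrB; apply: eq_bigr => i _; rewrite yE mulmxBr opprB addrA subrK//.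
  by rewrite fixed_point_gradient_sum minimizer_gradient_sum subrr.
clearbody z; rewrite -mulrA mulr_natl -[X in _ *+ X]card_ord -sumr_const mulr_sumr.
rewrite dot_block mulr_sumr -subr_ge0 -sumrB.
(* [(y + z) Q (y + z) >= 0] gives [y Q y - z Q z >= - 2 z Q (y + z)] *)
apply: (@le_trans _ _ (- 2 * \sum_i dot z (Q i *m (block y i + z)))).
  by rewrite sum0 mulr0.
rewrite mulr_sumr; apply: ler_sum => i _.
have zQ := loewner_ge z (hQmu i).
have yQ := loewner_le_quad (block y i) (hQL i).
have yzQ : 0 <= dot (block y i + z) (Q i *m (block y i + z)).
  by apply: le_trans (loewner_ge _ (hQmu i)); rewrite mulr_ge0 ?dot_ge0 ?(ltW hmu).
move: yzQ; rewrite mulmxDr !dotDr !dotDl.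
rewrite (_ : dot (block y i) (Q i *m z) = dot z (Q i *m block y i)); last first.
  by rewrite dot_mulmx hQsym dotC.
lra.
Qed.

(** Pythagoras: the blocks of [y] sum to zero, so the cross terms with the constant deviation [z]
    vanish and the squared distance is [dot y y + N%:R * dot z z]. *)
Lemma bias_bound :
  dot (xinf - stack (fun _ => xopt)) (xinf - stack (fun _ => xopt)) <=
  (1 + L / mu) * (alpha ^+ 2 * (2 * L * \sum_i (f i 0 - fstar i)) /
                  (1 - lam`_1) ^+ 2).
Proof.
have [lam1 _] := consensus_gap hW hWsym he hWe hN hlam lam_sorted.
set z := xbar - xopt.
have yE i : block (xinf - stack (fun _ => xopt)) i = block y i + z.
  by rewrite /y /z !blockB !block_stack addrA subrK.
have sum0 : \sum_i block y i = 0.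
  apply/colP => s; rewrite summxE mxE -[RHS](dot_slice_centered s) dotE.
  by apply: eq_bigr => i _; rewrite [in RHS]mxE mul1r !mxE.
have zy : N%:R * dot z z <= L / mu * dot y y.
  by have := mean_error; rewrite -/z -mulrA -ler_pdivlMl// mulrA (mulrC mu^-1).
clearbody z.
have -> : dot (xinf - stack (fun _ => xopt)) (xinf - stack (fun _ => xopt)) =
    dot y y + N%:R * dot z z.
  rewrite dot_block (dot_block y).
  under eq_bigr => i _ do rewrite yE dotDl !dotDr (dotC (block y i) z) -addrA.
  rewrite !big_split /= sumr_const card_ord mulr_natl -!dot_sumr sum0 dot0r.
  by rewrite !add0r.
apply: (@le_trans _ _ ((1 + L / mu) * dot y y)); first by rewrite mulrDl mul1r lerD2l.
rewrite ler_wpM2l ?addr_ge0 ?divr_ge0 ?(ltW hmu) ?(ltW L0)//.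
rewrite ler_pdivlMr ?exprn_gt0 ?subr_gt0// mulrC.
apply: le_trans consensus_error _.
by rewrite ler_wpM2l ?sqr_ge0// gradient_bound.
Qed.
End Bias.
End Decentralized.

(** * Second moments *)

Section Probability.
Context {R : realType} (disp : measure_display) (T : measurableType disp)
  (P : probability T R).
Local Notation EP := (expectation P).

Lemma expectation_bigsum (I : Type) (s : seq I) (X : I -> T -> R) :
  (forall i, X i \in Lfun P 1) ->
  (fun t => \sum_(i <- s) X i t) \in Lfun P 1 /\
  EP (fun t => \sum_(i <- s) X i t) = (\sum_(i <- s) EP (X i))%E.
Proof.
move=> LX; elim: s => [|i s [Ls Es]].
  have -> : (fun t => \sum_(i <- [::]) X i t) = cst 0.
    by apply/funext => t; rewrite big_nil.
  by rewrite big_nil expectation_cst Lfun_cst.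
have -> : (fun t => \sum_(j <- i :: s) X j t) = X i \+ (fun t => \sum_(j <- s) X j t).
  by apply/funext => t; rewrite big_cons.
split; first by apply: rpredD.
by rewrite expectationD// Es big_cons.
Qed.

Lemma expectation_scale (X : T -> R) (a : R) : X \in Lfun P 1 ->
  (fun t => a * X t) \in Lfun P 1 /\
  EP (fun t => a * X t) = (a%:E * EP (X))%E.
Proof.
move=> LX; have -> : (fun t => a * X t) = a \o* X.
  by apply/funext => t; rewrite /= mulrC.
by split; [exact: Lfun_scale | exact: expectationZl].
Qed.

(** The square splits into a constant, a centred linear part [lin], and a double sum [qd] of which
    only the diagonal survives in expectation. Square integrability makes every product
    integrable. *)
Lemma expectation_sum_sqr (J I : finType) (b : J -> R) (m : J -> I -> R)
    (eta : I -> T -> R) (c : R) :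
  (forall i, eta i \in Lfun P 2%:E) -> (forall i, EP (eta i) = 0%E) ->
  (forall i j, EP (eta i \* eta j) = ((i == j)%:R * c)%:E) ->
  EP (fun t => \sum_a (b a + \sum_i m a i * eta i t) ^+ 2) =
  (\sum_a b a ^+ 2 + c * \sum_i \sum_a m a i ^+ 2)%:E.
Proof.
move=> eta2 eta0 etac.
have eta1 i : eta i \in Lfun P 1.
  by apply: (Lfun_subset12 (fin_num_measure P _ measurableT)); exact: eta2.
have etaM i j : eta i \* eta j \in Lfun P 1 by exact: Lfun2_mul_Lfun1.
pose lin (t : T) := \sum_i (2 * \sum_a b a * m a i) * eta i t.
pose qd (t : T) := \sum_i \sum_j (\sum_a m a i * m a j) * (eta i \* eta j) t.
have -> : (fun t => \sum_a (b a + \sum_i m a i * eta i t) ^+ 2) =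
    (cst (\sum_a b a ^+ 2) \+ lin) \+ qd.
  apply/funext => t; rewrite /lin /qd /=.
  have -> : \sum_i (2 * \sum_a b a * m a i) * eta i t =
      \sum_a 2 * b a * \sum_i m a i * eta i t.
    under [RHS]eq_bigr do rewrite mulr_sumr.
    rewrite [RHS]exchange_big; apply: eq_bigr => i _ /=.
    by rewrite mulr_sumr mulr_suml; apply: eq_bigr => a _; ring.
  have -> : \sum_i \sum_j (\sum_a m a i * m a j) * (eta i t * eta j t) =
      \sum_a (\sum_i m a i * eta i t) ^+ 2.
    under [RHS]eq_bigr do rewrite expr2 mulr_suml.
    rewrite [RHS]exchange_big; apply: eq_bigr => i _ /=.
    under [RHS]eq_bigr do rewrite mulr_sumr.
    rewrite [RHS]exchange_big; apply: eq_bigr => j _ /=.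
    by rewrite mulr_suml; apply: eq_bigr => a _; ring.
  by rewrite -!big_split; apply: eq_bigr => a _ /=; ring.
have [Ll El] : lin \in Lfun P 1 /\ EP (lin) = 0%E.
  have [L E] := @expectation_bigsum _ (index_enum I)
    (fun i t => (2 * \sum_a b a * m a i) * eta i t)
    (fun i => (expectation_scale _ (eta1 i)).1).
  split; [exact: L | rewrite E big1// => i _].
  by rewrite (expectation_scale _ (eta1 i)).2 eta0 mule0.
have [Lq Eq] : qd \in Lfun P 1 /\
    EP (qd) = (c * \sum_i \sum_a m a i ^+ 2)%:E.
  have LE i := @expectation_bigsum _ (index_enum I)
    (fun j t => (\sum_a m a i * m a j) * (eta i \* eta j) t)
    (fun j => (expectation_scale _ (etaM i j)).1).
  have [L E] := @expectation_bigsum _ (index_enum I) _ (fun i => (LE i).1).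
  split; [exact: L | rewrite E mulr_sumr -sumEFin; apply: eq_bigr => i _].
  rewrite (LE i).2 (bigD1 i)//= [X in (_ + X)%E]big1 => [|j ji].
    rewrite (expectation_scale _ (etaM i i)).2 etac eqxx mul1r adde0 -EFinM.
    by rewrite mulrC; congr (_ * _)%:E; apply: eq_bigr => a _; rewrite expr2.
  rewrite (expectation_scale _ (etaM i j)).2 etac eq_sym (negbTE ji) mul0r.
  by rewrite mule0.
rewrite expectationD//; last by rewrite rpredD// Lfun_cst.
rewrite expectationD//; last by rewrite Lfun_cst.
by rewrite expectation_cst El Eq adde0 EFinD.
Qed.

(** The joint law agrees with the product of the marginals on rectangles, hence everywhere; Fubini
    then separates the two integrals. *)
Lemma expectation_indep (X Y : {RV P >-> R}) :
  (forall A B, measurable A -> measurable B ->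
    P (X @^-1` A `&` Y @^-1` B) = (P (X @^-1` A) * P (Y @^-1` B))%E) ->
  (X : T -> R) \in Lfun P 1 -> (Y : T -> R) \in Lfun P 1 ->
  (X \* Y : T -> R) \in Lfun P 1 ->
  EP (X \* Y) = (EP (X) * EP (Y))%E.
Proof.
move=> indep LX LY LXY.
pose XY t := (X t, Y t).
have mXY : measurable_fun setT XY by apply: measurable_fun_pair; exact: measurable_funPT.
pose h (z : R * R) := (z.1 * z.2)%:E.
have mh : measurable_fun [set: (R * R)%type] h.
  apply/measurable_EFinP; apply: measurable_funM.
    exact: measurable_fst.
  exact: measurable_snd.
pose mX : probability _ R := distribution P X.
pose mY : probability _ R := distribution P Y.
pose mXYd := distribution P (mfun_Sub (mem_set mXY)).
have iXY : P.-integrable setT (h \o XY) by exact/Lfun1_integrable.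
have ih : mXYd.-integrable setT h by exact: integrable_pushforward.
have prodE A : measurable A -> (mX \x mY)%E A = mXYd A.
  by move=> mA; exact: (@product_measure_unique _ _ _ _ _ mX mY mXYd).
have intE g : (\int[mX \x mY]_z g z)%E = (\int[mXYd]_z g z)%E.
  by apply: eq_measure_integral => A mA _; exact: prodE.
(* Fubini requires integrability for the product measure, which is carried over from the joint
   law. *)
have iprod : (mX \x mY)%E.-integrable setT h.
  by apply/integrableP; split => //; rewrite intE; case/integrableP: ih.
have -> : EP (X \* Y) = (\int[mX \x mY]_z h z)%E.
  by rewrite unlock intE integral_pushforward.
rewrite -integral12_prod_meas1//.
have LY1 : mY.-integrable setT EFin.
  apply: integrable_pushforward => //; exact/Lfun1_integrable.
have LX1 : mX.-integrable setT EFin.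
  apply: integrable_pushforward => //; exact/Lfun1_integrable.
have EY : (\int[mY]_y y%:E)%E = EP Y.
  rewrite unlock integral_distribution//; exact/Lfun1_integrable.
have EX : (\int[mX]_y y%:E)%E = EP X.
  rewrite unlock integral_distribution//; exact/Lfun1_integrable.
transitivity (\int[mX]_x (x%:E * EP Y))%E.
  apply: eq_integral => x _.
  by rewrite -EY -integralZl//; apply: eq_integral => y _; rewrite -EFinM.
by rewrite -(fineK (expectation_fin_num LY)) integralZr// EX.
Qed.

Lemma covariance_zero_mean (X Y : T -> R) :
  X \in Lfun P 2%:E -> Y \in Lfun P 2%:E -> EP X = 0%E ->
  covariance P X Y = EP (X \* Y).
Proof.
move=> LX LY X0; have L1 := Lfun_subset12 (fin_num_measure P _ measurableT).
have LXY : (X * Y)%R \in Lfun P 1 by exact: Lfun2_mul_Lfun1.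
by rewrite (covarianceE (L1 _ LX) (L1 _ LY) LXY) X0 mul0e sube0.
Qed.

End Probability.

(** * Moments of the stacked noise *)

Section NoiseMoments.
Context {R : realType} {N d : nat} (disp : measure_display)
  (T : measurableType disp) (P : probability T R).
Local Notation EP := (expectation P).
Variables (v : R) (w : nat * 'I_N -> {RV P >-> @borel_cV R d}).
Hypotheses (hw_indep : mutually_independent w)
  (hw_mean : forall ki, zero_mean P (w ki))
  (hw_cov : forall ki, has_covariance P (w ki) v%:M).

Lemma measurable_coord s :
  measurable_fun [set: @borel_cV R d] (fun u : @borel_cV R d => (u : 'cV[R]_d) s 0).
Proof.
apply: (@measurability _ _ (@borel_cV R d) R setT
  (fun u : @borel_cV R d => (u : 'cV[R]_d) s 0) _ (RGenOInfty.measurableE R))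
  => _ [_ [x ->] <-].
apply: sub_sigma_algebra; rewrite setTI.
apply: open_comp; last by rewrite set_itvE; exact: open_gt.
by move=> u _; exact: coord_continuous.
Qed.

Let coordT ki s := measurableT_comp (measurable_coord s) (measurable_funPT (w ki)).

Lemma noise_moment (ki lj : nat * 'I_N) (s s' : 'I_d) :
  EP (Defs.coord (w ki) s \* Defs.coord (w lj) s') =
  (((ki, s) == (lj, s'))%:R * v)%:E.
Proof.
have L2 kj r : Defs.coord (w kj) r \in Lfun P 2%:E by apply: (hw_cov kj).1.
have L1 kj r : Defs.coord (w kj) r \in Lfun P 1.
  by apply: (Lfun_subset12 (fin_num_measure P _ measurableT)); exact: L2.
have LM kj lj' r r' : Defs.coord (w kj) r \* Defs.coord (w lj') r' \in Lfun P 1.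
  by apply: Lfun2_mul_Lfun1.
rewrite xpair_eqE; have [<-|kl] /= := eqVneq ki lj.
  have <- : covariance P (Defs.coord (w ki) s) (Defs.coord (w ki) s') =
      EP (Defs.coord (w ki) s \* Defs.coord (w ki) s').
    exact: (covariance_zero_mean (L2 _ _) (L2 _ _) (hw_mean ki s)).
  by rewrite (hw_cov ki).2 mxE mulr_natl.
pose X : {RV P >-> R} := mfun_Sub (mem_set (coordT ki s)).
pose Y : {RV P >-> R} := mfun_Sub (mem_set (coordT lj s')).
have -> : EP (Defs.coord (w ki) s \* Defs.coord (w lj) s') = EP (X \* Y) by [].
rewrite expectation_indep; [|move=> A B mA mB|exact: L1|exact: L1|exact: LM].
  have -> : EP X = 0%E by exact: hw_mean.
  by rewrite mul0e mul0r.
(* Independence takes a family of events over all indices; only its values at [ki] and [lj] matter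
   for the two-element list. *)
pose C (x : nat * 'I_N) : set (@borel_cV R d) :=
  if x == ki then (fun u : @borel_cV R d => (u : 'cV[R]_d) s 0) @^-1` A
  else (fun u : @borel_cV R d => (u : 'cV[R]_d) s' 0) @^-1` B.
have mC x : measurable (C x).
  by rewrite /C; case: ifP => _; rewrite -[_ @^-1` _]setTI; exact: measurable_coord.
have := hw_indep (s := [:: ki; lj]) (B := C) _ mC.
rewrite /= inE kl => /(_ isT).
rewrite !big_cons big_nil mule1 /C eqxx (eq_sym lj) (negbTE kl) => <-.
congr (P _); apply/seteqP; split=> [t [XA YB] x /=|t wC].
  by rewrite !inE => /orP[] /eqP ->; rewrite ?eqxx// (eq_sym lj) (negbTE kl).
split; first by have := wC ki; rewrite /= inE !eqxx; exact.
by have := wC lj; rewrite /= !inE !eqxx orbT (eq_sym lj) (negbTE kl); exact.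
Qed.

(** All noises are flattened into one uncorrelated scalar family indexed by step and coordinate; the
    squared entries of [M j] sum to the trace of its Gram matrix. *)
Lemma expectation_affine_noise m k (b : 'cV[R]_m) (M : nat -> 'M[R]_(m, N * d)) :
  EP (fun t => l2norm (b +
      \sum_(j < k) (M j *m stack (fun i => w (j : nat, i) t))) ^+ 2) =
  (dot b b + v * \sum_(j < k) \tr ((M j)^T *m M j))%:E.
Proof.
pose eta (z : 'I_k * 'I_(N * d)) : T -> R :=
  Defs.coord (w (z.1 : nat, (mxtens_unindex z.2).1)) (mxtens_unindex z.2).2.
have -> : (fun t => l2norm (b +
      \sum_(j < k) (M j *m stack (fun i => w (j : nat, i) t))) ^+ 2) =
    (fun t => \sum_a (b a 0 + \sum_(z : 'I_k * 'I_(N * d)) M z.1 a z.2 * eta z t) ^+ 2).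
  apply/funext => t; rewrite l2norm_sqr dotE; apply: eq_bigr => a _.
  rewrite -expr2 mxE; congr ((_ + _) ^+ 2).
  rewrite summxE -(pair_bigA _ (fun (j : 'I_k) c => M j a c * eta (j, c) t)) /=.
  by apply: eq_bigr => j _; rewrite mxE; apply: eq_bigr => c _; rewrite !mxE.
rewrite (expectation_sum_sqr _ _ (c := v)).
- congr (_ + _ * _)%:E; first by rewrite dotE; apply: eq_bigr => a _; rewrite expr2.
  rewrite -(pair_bigA _ (fun (j : 'I_k) c => \sum_a M j a c ^+ 2)) /=.
  apply: eq_bigr => j _; rewrite /mxtrace; apply: eq_bigr => c _.
  by rewrite mxE; apply: eq_bigr => a _; rewrite !mxE expr2.
- by move=> z; apply: (hw_cov _).1.
- by move=> z; apply: hw_mean.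
move=> [j a] [j' a']; rewrite noise_moment; congr (_%:R * _)%:E.
rewrite !xpair_eqE /= -(inj_eq (can_inj (@mxtens_unindexK N d)) a a').
by rewrite /mxtens_unindex xpair_eqE -andbA.
Qed.

End NoiseMoments.

(** * The distributed stochastic gradient iteration *)

Section SecondMoment.
Context {R : realType}.

Lemma geometric_sum_le (q : R) k : 0 <= q < 1 ->
  \sum_(j < k) q ^+ j <= (1 - q)^-1.
Proof.
move=> /andP[q0 q1]; rewrite -[leRHS]mul1r ler_pdivlMr ?subr_gt0//.
by rewrite mulrC -opprB mulNr -subrX1 opprB lerBlDr lerDl exprn_ge0.
Qed.

Lemma spectrum_radius n (A : 'M[R]_n) (s : seq R) m : m \in s ->
  `|m| <= \big[Num.max/0]_(l <- s) `|l|.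
Proof. by move=> ms; apply: (le_bigmax_seq _ m xpredT (fun l : R => `|l|)). Qed.

Lemma trace_power_sum_le n (A : 'M[R]_n) (s : seq R) k :
  A^T = A -> is_spectrum A s -> \big[Num.max/0]_(m <- s) `|m| < 1 ->
  \sum_(j < k) \tr (A ^+ (2 * (k - j.+1))) <= \sum_(m <- s) (1 - m ^+ 2)^-1.
Proof.
move=> Asym As rho1.
(* Reversing the order of summation turns the exponents into [2 * j], giving for each eigenvalue a
   geometric series of ratio [m ^+ 2]. *)
rewrite (reindex_inj rev_ord_inj) /=.
under eq_bigr => j _ do
  rewrite subnSK ?ltn_ord// subKn 1?ltnW// (spectrum_mxtrace Asym As).
rewrite exchange_big /= big_seq [leRHS]big_seq; apply: ler_sum => m ms.
under eq_bigr do rewrite exprM.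
apply: geometric_sum_le; rewrite sqr_ge0 /= -real_normK ?num_real//.
by rewrite expr_lt1// (le_lt_trans (spectrum_radius A ms)).
Qed.

Lemma dot_sqr_le n (a b : 'cV[R]_n) :
  dot (a + b) (a + b) <= 2 * dot a a + 2 * dot b b.
Proof.
have := dot_ge0 (a - b).
rewrite !dotDl !dotDr !dotNl !dotNr (dotC b a); lra.
Qed.

Section Dsg.
Variables (N d : nat) (Q : 'I_N -> 'M[R]_d) (p : 'I_N -> 'cV[R]_d).
Variables (W : 'M[R]_N) (alpha v : R).
Hypotheses (hQsym : forall i, (Q i)^T = Q i) (hWsym : W^T = W).
Local Notation WI := (W *t (1%:M : 'M[R]_d)).
Local Notation AQ := (WI - alpha *: block_diag Q).
Local Notation G x := (block_diag Q *m x - stack p).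
Variable xinf : 'cV[R]_(N * d).
Hypothesis hxinf : (1%:M - WI) *m xinf + alpha *: G xinf = 0.
Variables (disp : measure_display) (T : measurableType disp) (P : probability T R).
Variable w : nat * 'I_N -> {RV P >-> @borel_cV R d}.
Hypotheses (hw_indep : mutually_independent w)
  (hw_mean : forall ki, zero_mean P (w ki))
  (hw_cov : forall ki, has_covariance P (w ki) v%:M).

(** The centre [c] is free so that both [xinf] and the stacked optimum can be substituted. By
    symmetry the Gram matrix of each noise coefficient is [alpha ^+ 2] times an even power. *)
Lemma dsg_second_moment (x0 c : 'cV[R]_(N * d)) k :
  expectation P (fun t => l2norm (dsg W alpha (fun x => G x) x0
      (fun j => stack (fun i => w (j, i) t)) k - c) ^+ 2) =
  (dot (AQ ^+ k *m (x0 - xinf) + (xinf - c)) (AQ ^+ k *m (x0 - xinf) + (xinf - c))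
   + alpha ^+ 2 * v * \sum_(j < k) \tr (AQ ^+ (2 * (k - j.+1))))%:E.
Proof.
have AT := AQ_sym hQsym hWsym alpha.
pose M j : 'M[R]_(N * d) := - alpha *: AQ ^+ (k - j.+1).
transitivity (expectation P (fun t => l2norm (AQ ^+ k *m (x0 - xinf) + (xinf - c) +
    \sum_(j < k) (M j *m stack (fun i => w (j : nat, i) t))) ^+ 2)).
  congr expectation; apply/funext => t; congr (l2norm _ ^+ 2).
  rewrite -[X in X - c](subrK xinf) (dsg_error hxinf) -!addrA; congr (_ + _).
  rewrite addrC addrA; congr (_ + _).
  rewrite -scaleNr scaler_sumr; apply: eq_bigr => j _.
  by rewrite /M -scalemxAl.
rewrite (expectation_affine_noise hw_indep hw_mean hw_cov).
rewrite (mulrC _ v) -mulrA; congr (_ + _ * _)%:E.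
rewrite mulr_sumr; apply: eq_bigr => j _.
have -> : (M j)^T = M j by rewrite /M linearZ /= trmx_expr_sym.
rewrite /M -scalemxAl -scalemxAr scalerA mxtraceZ mulrNN -expr2.
by rewrite mulmxE -exprD addnn mul2n.
Qed.

Variable s : seq R.
Hypothesis hs : is_spectrum AQ s.
Let rho := \big[Num.max/0]_(m <- s) `|m|.

Lemma dsg_variance_le k : 0 <= v -> rho < 1 ->
  alpha ^+ 2 * v * \sum_(j < k) \tr (AQ ^+ (2 * (k - j.+1))) <=
  alpha ^+ 2 * v * \sum_(m <- s) (1 - m ^+ 2)^-1.
Proof.
move=> v0 rho1; apply: ler_wpM2l; first by rewrite mulr_ge0// sqr_ge0.
exact: (trace_power_sum_le k (AQ_sym hQsym hWsym alpha) hs rho1).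
Qed.

(** The free bound [q] serves for both [rho] and [1 - alpha * mu]. *)
Lemma dsg_bias_le (q : R) (xi : 'cV[R]_(N * d)) k : rho <= q ->
  dot (AQ ^+ k *m xi) (AQ ^+ k *m xi) <= q ^+ (2 * k) * spectral_norm (xi *m xi^T).
Proof.
move=> rq; have rho0 : 0 <= rho by exact: bigmax_ge_id.
have AT := AQ_sym hQsym hWsym alpha.
rewrite dot_expr//; apply: le_trans (spectrum_pow_le AT hs _ _) _.
apply: ler_pM; rewrite ?exprn_ge0 ?dot_ge0//; last exact: spectral_norm_outer.
by rewrite lerXn2r ?nnegrE// (le_trans rho0).
Qed.

End Dsg.
End SecondMoment.

Theorem theorem35 (R : realType) (N d : nat) (hN : (1 < N)%N) (hd : (0 < d)%N)
  (mu L : R) (hmu : 0 < mu) (hmuL : mu <= L)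
  (* local objectives *)
  (Q : 'I_N -> 'M[R]_d) (p : 'I_N -> 'cV[R]_d) (r : 'I_N -> R)
  (hQsym : forall i, (Q i)^T = Q i)
  (hQmu : forall i, loewner_le mu%:M (Q i))
  (hQL : forall i, loewner_le (Q i) L%:M)
  (f : 'I_N -> 'cV[R]_d -> R) (hf : f = fun i => quad (Q i) (p i) (r i))
  (fstar : 'I_N -> R) (hfstar : forall i, is_minimum (f i) (fstar i))
  (xopt : 'cV[R]_d) (hxopt : is_minimizer (average f) xopt)
  (* network *)
  (e : rel 'I_N) (W : 'M[R]_N)
  (he : connected_graph e) (hWsym : W^T = W) (hW : doubly_stochastic W)
  (hWe : compatible_with_graph e W)
  (lamW : N.-tuple R) (hlamW : is_spectrum W lamW)
  (hlamW_sorted : sorted >=%R lamW)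
  (* stepsize, eigenvalues of A_Q, fixed point *)
  (alpha : R) (halpha : 0 < alpha)
  (muA : (N * d).-tuple R)
  (hmuA : is_spectrum (W *t (1%:M : 'M[R]_d) - alpha *: block_diag Q) muA)
  (xinf : 'cV[R]_(N * d))
  (hxinf : (1%:M - W *t (1%:M : 'M[R]_d)) *m xinf
             + alpha *: grad (separable_sum f) xinf = 0)
  (x0 : 'cV[R]_(N * d))
  (* noise: w (k, i) is the noise at node i in the step from k to k + 1 *)
  (disp : measure_display) (T : measurableType disp) (P : probability T R)
  (sigma : R) (w : nat * 'I_N -> {RV P >-> borel_cV d})
  (hw_indep : mutually_independent w)
  (hw_ident : identically_distributed w)
  (hw_mean : forall ki, zero_mean P (w ki))
  (hw_cov : forall ki, has_covariance P (w ki) (sigma ^+ 2 / d%:R)%:M) :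
  let x (k : nat) (t : T) : 'cV[R]_(N * d) :=
    dsg W alpha (grad (separable_sum f)) x0
        (fun j => stack (fun i => w (j, i) t)) k in
  let xstar : 'cV[R]_(N * d) := stack (fun _ : 'I_N => xopt) in
  let lam2 : R := lamW`_1 in
  let lamN : R := lamW`_N.-1 in
  let gamma : R := Num.max `|lam2| `|lamN| in
  let rho : R := \big[Num.max/0]_(m <- muA) `|m| in
  let xi0 : 'cV[R]_(N * d) := x0 - xinf in
  let nxi0 : R := spectral_norm (xi0 *m xi0^T) in
  let S : R := \sum_(m <- muA) (1 - m ^+ 2)^-1 in
  let C1 : R := Num.sqrt (2 * L * \sum_i (f i 0 - fstar i))
              * (1 + 2 * (L + mu) / mu) in
  [/\ rho < 1 -> forall k : nat,
        ('E_P[fun t => (l2norm (x k t - xinf) ^+ 2)%R] <=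
         (rho ^+ (2 * k)
            * (nxi0 + alpha ^+ 2 * sigma ^+ 2 * N%:R / (1 - rho ^+ 2))
          + alpha ^+ 2 * (sigma ^+ 2 / d%:R) * S)%:E)%E,
      alpha <= (1 + lamN) / (L + mu) -> forall k : nat,
        ('E_P[fun t => (l2norm (x k t - xinf) ^+ 2)%R] <=
         ((1 - alpha * mu) ^+ (2 * k)
            * (nxi0 + alpha ^+ 2 * sigma ^+ 2 * N%:R
                        / (1 - (1 - alpha * mu) ^+ 2))
          + alpha ^+ 2 * (sigma ^+ 2 / d%:R) * S)%:E)%E
    & alpha <= (1 + lamN) / (L + mu) -> alpha <= 1 / (L + mu) ->
      forall k : nat,
        ('E_P[fun t => (l2norm (x k t - xstar) ^+ 2)%R] <=
         ((1 - alpha * mu) ^+ (2 * k)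
            * (2 * nxi0 + 2 * alpha ^+ 2 * sigma ^+ 2 * N%:R
                            / (1 - (1 - alpha * mu) ^+ 2))
          + 2 * alpha ^+ 2 * sigma ^+ 2 / d%:R * S
          + 2 * alpha ^+ 2 * C1 ^+ 2 * N%:R / (1 - gamma) ^+ 2)%:E)%E].
Proof.
move=> x xstar lam2 lamN gamma rho xi0 nxi0 S C1.
have L0 : 0 < L := lt_le_trans hmu hmuL.
have gradE : grad (separable_sum f) = fun y => block_diag Q *m y - stack p.
  by apply/funext => y; rewrite hf grad_separable_quad.
have fixE : (1%:M - W *t (1%:M : 'M[R]_d)) *m xinf
    + alpha *: (block_diag Q *m xinf - stack p) = 0.
  by move: hxinf; rewrite gradE.
pose v := sigma ^+ 2 / d%:R.
have v0 : 0 <= v by rewrite divr_ge0 ?sqr_ge0.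
have momentE c k : 'E_P[fun t => (l2norm (x k t - c) ^+ 2)%R]%E = _ :=
  etrans (congr1 (fun g => expectation P (fun t => l2norm (dsg W alpha g x0
      (fun j => stack (fun i => w (j, i) t)) k - c) ^+ 2)) gradE)
    (dsg_second_moment hQsym hWsym fixE hw_indep hw_mean hw_cov x0 c k).
have rho0 : 0 <= rho by exact: bigmax_ge_id.
have var_le k : rho < 1 -> _ := dsg_variance_le hQsym hWsym hmuA k v0.
have tail_ge0 q : 0 <= q < 1 -> 0 <= alpha ^+ 2 * sigma ^+ 2 * N%:R / (1 - q ^+ 2).
  move=> /andP[q0 q1]; apply: divr_ge0; last by rewrite subr_ge0 expr_le1// ltW.
  by apply: mulr_ge0 => //; apply: mulr_ge0; exact: sqr_ge0.
(* The moment formula gives the bound with [nxi0] alone; the fraction is nonnegative and is added by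
   monotonicity. *)
have bound q k : rho <= q -> q < 1 ->
  ('E_P[fun t => (l2norm (x k t - xinf) ^+ 2)%R] <=
   (q ^+ (2 * k) * (nxi0 + alpha ^+ 2 * sigma ^+ 2 * N%:R / (1 - q ^+ 2))
    + alpha ^+ 2 * v * S)%:E)%E.
  move=> rq q1; rewrite momentE lee_fin subrr addr0.
  apply: lerD; last exact: var_le (le_lt_trans rq q1).
  apply: le_trans (dsg_bias_le hQsym hWsym hmuA xi0 k rq) _.
  rewrite ler_wpM2l ?exprn_ge0 ?(le_trans rho0)// lerDl tail_ge0//.
  by rewrite (le_trans rho0).
have rho_le : alpha <= (1 + lamN) / (L + mu) -> rho <= 1 - alpha * mu.
  exact: (AQ_spectrum_le hN hmu hmuL hQsym hQmu hQL hWsym hW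
    hlamW hlamW_sorted halpha hmuA).
have am1 : 1 - alpha * mu < 1 by rewrite ltrBlDr ltrDl mulr_gt0.
split=> [rho1 k|aL k|aL _ k].
- exact: bound.
- by apply: bound => //; exact: rho_le.
have rq := rho_le aL.
rewrite momentE lee_fin.
have fstar_le i y : fstar i <= quad (Q i) (p i) (r i) y.
  by have [z zmin <-] := hfstar i; have := zmin y; rewrite hf.
have xmin : is_minimizer (average (fun i => quad (Q i) (p i) (r i))) xopt.
  by move: hxopt; rewrite hf.
have [lam21 _] := consensus_gap hW hWsym he hWe hN hlamW hlamW_sorted.
have bias := bias_bound hN hmu hmuL hQsym hQmu hQL he hWsym hW hWe hlamW
  hlamW_sorted halpha fixE fstar_le xmin.
pose D := 2 * L * \sum_i (quad (Q i) (p i) (r i) 0 - fstar i).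
have D0 : 0 <= D.
  apply: mulr_ge0; first by rewrite mulr_ge0// ltW.
  by apply: sumr_ge0 => i _; rewrite subr_ge0.
have lamN2 : lamN <= lam2.
  by apply: sorted_ge_nth => //; rewrite size_tuple ltn_predL (ltnW hN)
    andbT -subn1 subn_gt0.
(* A positive stepsize below the threshold already forces [1 + lamN] to be positive. *)
have lamNgt : -1 < lamN.
  move: aL; rewrite ler_pdivlMr ?addr_gt0// => aL.
  have : 0 < alpha * (L + mu) by rewrite mulr_gt0 ?addr_gt0.
  lra.
have gamma1 : gamma < 1.
  by rewrite gt_max !ltr_norml lam21 lamNgt (le_lt_trans lamN2 lam21)
    (lt_le_trans lamNgt lamN2).
have gap : 1 - gamma <= 1 - lam2.
  by rewrite lerD2l lerN2 le_max ler_norm.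
have C1E : C1 ^+ 2 = D * (1 + 2 * (L + mu) / mu) ^+ 2.
  by rewrite /C1 exprMn hf sqr_sqrtr.
have bias_le : dot (xinf - xstar) (xinf - xstar) <=
    alpha ^+ 2 * C1 ^+ 2 * N%:R / (1 - gamma) ^+ 2.
  apply: le_trans bias _; rewrite -/D.
  have Lmu : 0 <= L / mu by rewrite divr_ge0 ?ltW.
  (* With [t = L / mu] nonnegative, this reads [1 + t <= (3 + 2 t)^2]. *)
  have factor : 1 + L / mu <= (1 + 2 * (L + mu) / mu) ^+ 2.
    have -> : 1 + 2 * (L + mu) / mu = 3 + 2 * (L / mu) by field; rewrite gt_eqF.
    nra.
  (* Since [gamma] dominates the second eigenvalue and stays below 1, replacing the gap by
     [1 - gamma] only weakens the bound; so does the factor [N%:R >= 1]. *)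
  have inv_le : ((1 - lamW`_1) ^+ 2)^-1 <= ((1 - gamma) ^+ 2)^-1.
    have g0 : 0 < 1 - gamma by rewrite subr_gt0.
    have l0 : 0 < 1 - lamW`_1 by rewrite subr_gt0.
    by rewrite lef_pV2 ?posrE ?exprn_gt0// lerXn2r// nnegrE ltW.
  have N1 : 1 <= N%:R :> R by rewrite ler1n ltnW.
  have aD : 0 <= alpha ^+ 2 * D by rewrite mulr_ge0 ?sqr_ge0.
  rewrite C1E mulrA.
  apply: ler_pM => //.
  + by rewrite mulr_ge0// addr_ge0.
  + by rewrite invr_ge0 sqr_ge0.
  rewrite mulrC (mulrA (alpha ^+ 2)) -mulrA ler_wpM2l//.
  by apply: le_trans factor _; rewrite ler_peMr ?sqr_ge0.
(* Separates the transient from the bias, which is where the factors 2 on both come from. *)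
apply: le_trans (lerD (dot_sqr_le _ _) (lexx _)) _.
have bl := dsg_bias_le hQsym hWsym hmuA xi0 k rq.
have vl := var_le k (le_lt_trans rq am1).
have tl : 0 <= (1 - alpha * mu) ^+ (2 * k) *
    (alpha ^+ 2 * sigma ^+ 2 * N%:R / (1 - (1 - alpha * mu) ^+ 2)).
  by rewrite mulr_ge0 ?tail_ge0 ?exprn_ge0 ?(le_trans rho0 rq).
(* The noise term occurs once in the moment and twice in the claim, hence the need for its sign. *)
have vl0 : 0 <= alpha ^+ 2 * v * S.
  apply: le_trans vl; apply: mulr_ge0; first by rewrite mulr_ge0// sqr_ge0.
  rewrite sumr_ge0// => j _; rewrite (spectrum_mxtrace (AQ_sym hQsym hWsym alpha) hmuA).
  by rewrite sumr_ge0// => m _; rewrite exprM exprn_ge0 ?sqr_ge0.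
set E := (1 - alpha * mu) ^+ (2 * k) in bl tl *.
set tl0 := _ / (1 - (1 - alpha * mu) ^+ 2) in tl.
have -> : E * (2 * nxi0 +
    2 * alpha ^+ 2 * sigma ^+ 2 * N%:R / (1 - (1 - alpha * mu) ^+ 2)) =
    2 * (E * nxi0) + 2 * (E * tl0).
  by rewrite /tl0; ring.
have -> : 2 * alpha ^+ 2 * sigma ^+ 2 / d%:R * S = 2 * (alpha ^+ 2 * v * S).
  by rewrite /v; ring.
have -> : 2 * alpha ^+ 2 * C1 ^+ 2 * N%:R / (1 - gamma) ^+ 2 =
    2 * (alpha ^+ 2 * C1 ^+ 2 * N%:R / (1 - gamma) ^+ 2) by ring.
have combine (a b c A B C F : R) : a <= A -> b <= B -> c <= C -> 0 <= C ->
    0 <= F -> 2 * a + 2 * b + c <= 2 * A + 2 * F + 2 * C + 2 * B by lra.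
exact: combine.
Qed.
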